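(* There exists a complex manifold $Y$ with identically vanishing Kobayashi pseudodistance $d_Y$ whose infinitesimal Kobayashi-Royden pseudometric $F_Y$ is not identically vanishing (i.e. $F_Y\not\equiv 0$).
   Context: Let $\Delta=\{z\in\mathbb{C}:|z|<1\}$ be the unit disc and let $d_\Delta$ be the Poincaré distance on $\Delta$. For a complex manifold $Y$ and $p,q\in Y$, the Kobayashi pseudodistance $d_Y(p,q)$ is the infimum of $\sum_{i=1}^k d_\Delta(a_i,b_i)$ over all chains of discs from $p$ to $q$, i.e. over all $k\ge 1$, points $p=p_0,p_1,\dots,p_k=q$ of $Y$, points $a_i,b_i\in\Delta$ and holomorphic maps $f_i:\Delta\to Y$ with $f_i(a_i)=p_{i-1}$ and $f_i(b_i)=p_i$. It vanishes identically if $d_Y(p,q)=0$ for all $p,q\in Y$. The Kobayashi-Royden pseudometric $F_Y$ is defined, for $x\in Y$ and a tangent vector $v\in T_xY$, by $$F_Y(v)=\inf\{\lambda>0:\ \exists f:\Delta\to Y\text{ holomorphic with } f(0)=x,\ \lambda f'(0)=v\}.$$ *)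

(* Defs.v *)
From mathcomp Require Import all_boot all_order all_algebra.
From mathcomp Require Import complex.
From mathcomp Require Import all_classical all_reals all_analysis.

Set Implicit Arguments.
Unset Strict Implicit.
Unset Printing Implicit Defensive.

Import Order.TTheory GRing.Theory Num.Theory.
Import numFieldNormedType.Exports.

Local Open Scope classical_set_scope.
Local Open Scope ring_scope.

(* The type ascription makes the generic topology of a numFieldType, hence the
   structure of a normed module over itself, available on R[i]. *)
Definition Cplx (R : realType) : numClosedFieldType := R[i].

Definition real_modulus (R : realType) (z : Cplx R) : R := complex.Re `|z|.

Definition unit_disc (R : realType) : set (Cplx R) := [set z | `|z| < 1].

(* artanh |(a - b) / (1 - conj(b) a)|, the distance of the metric
   |dz| / (1 - |z|^2).  With this normalization the infinitesimal metric of the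
   disc is its Kobayashi-Royden metric. *)
Definition poincare_dist (R : realType) (a b : Cplx R) : R :=
  let rho := real_modulus ((a - b) / (1 - Num.conj b * a)) in
  ln ((1 + rho) / (1 - rho)) / 2.

(* A homeomorphism from an open subset of T onto an open subset of C^n; the two
   functions are total, their values off these open sets are irrelevant. *)
Record chart (R : realType) (T : topologicalType) (n : nat) := Chart {
  chart_dom : set T ;
  chart_fun :> T -> 'rV[Cplx R]_n ;
  chart_inv : 'rV[Cplx R]_n -> T ;
  open_chart_dom : open chart_dom ;
  open_chart_img : open (chart_fun @` chart_dom) ;
  chart_funK : forall x, chart_dom x -> chart_inv (chart_fun x) = x ;
  chart_fun_continuous :
    forall x, chart_dom x -> {for x, continuous chart_fun} ;
  chart_inv_continuous :
    forall z, (chart_fun @` chart_dom) z -> {for z, continuous chart_inv} }.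

(* Differentiability is over the field Cplx R, i.e. it is complex
   differentiability.  Exchanging phi and psi in atlas_compatible shows that
   the transition maps are biholomorphic. *)
Record complexManifold (R : realType) := ComplexManifold {
  carrier :> topologicalType ;
  dim : nat ;
  atlas : set (chart R carrier dim) ;
  manifold_hausdorff : hausdorff_space carrier ;
  manifold_second_countable : @second_countable carrier ;
  atlas_cover : forall x, exists2 phi, atlas phi & chart_dom phi x ;
  atlas_compatible : forall phi psi, atlas phi -> atlas psi ->
    forall z, (phi @` (chart_dom phi `&` chart_dom psi)) z ->
      differentiable (psi \o chart_inv phi) z }.

(* A map from the disc to Y is the restriction of a total function. *)
Definition holomorphic_disc (R : realType) (Y : complexManifold R)
    (f : Cplx R -> Y) : Prop :=
  forall z, unit_disc z ->
    {for z, continuous f} /\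
    forall phi : chart R Y (dim Y), atlas phi -> chart_dom phi (f z) ->
      derivable (phi \o f) z 1.

Definition charts_at (R : realType) (Y : complexManifold R) (x : Y) : Type :=
  {phi : chart R Y (dim Y) | atlas phi /\ chart_dom phi x}.

(* An element of T_x Y: its coordinate vectors in all the charts around x,
   related by the differentials of the transition maps. *)
Record tangent (R : realType) (Y : complexManifold R) (x : Y) := Tangent {
  tangent_coord :> charts_at x -> 'rV[Cplx R]_(dim Y) ;
  tangent_compatible : forall phi psi : charts_at x,
    tangent_coord psi =
    'd (sval psi \o chart_inv (sval phi)) (sval phi x) (tangent_coord phi) }.

(* The infimum is taken in the extended reals, so the pseudodistance of two
   points joined by no chain is +oo. *)
Definition kobayashi_dist (R : realType) (Y : complexManifold R) (x y : Y) :
    \bar R :=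
  ereal_inf [set s : \bar R | exists (k : nat) (p : nat -> Y)
      (a b : nat -> Cplx R) (f : nat -> Cplx R -> Y),
    [/\ (0 < k)%N,
        p 0%N = x,
        p k = y,
        forall i, (i < k)%N ->
          [/\ unit_disc (a i), unit_disc (b i), holomorphic_disc (f i),
              f i (a i) = p i & f i (b i) = p i.+1] &
        s = (\sum_(i < k) poincare_dist (a i) (b i))%:E]].

Definition kobayashi_royden (R : realType) (Y : complexManifold R) (x : Y)
    (v : tangent x) : \bar R :=
  ereal_inf [set l%:E | l in [set l : R | 0 < l /\
    exists f : Cplx R -> Y,
      [/\ holomorphic_disc f,
          f 0 = x &
          forall phi : charts_at x,
            (l%:C%C : Cplx R) *: derive1 (sval phi \o f) 0 = v phi]]].

(* Main.v *)
From HB Require Import structures.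
From mathcomp Require Import all_boot all_order all_algebra.
From mathcomp Require Import complex.
From mathcomp Require Import all_classical all_reals all_analysis.
From mathcomp Require Import ring lra.
Require Import Defs.

(** The countable group of rational affine maps w |-> a w + b, a > 0, acts on
    the upper half-plane H with dense orbits.  If B is a complex manifold
    with fundamental group acting through all these maps, then the flat bundle
    with fibre H over B carries locally a holomorphic coordinate w in H, unique
    up to the group.  A disc is simply connected, so w continues along it to a
    holomorphic map into H, and Cauchy's estimate bounds its derivative: F is
    nonzero in the directions of the fibres.  On the other hand, if parallel
    sections of the bundle over B are swept out by affine complex lines, then
    two points of a fibre whose w lie in the same orbit are at distance 0, and
    by density all points are.

    We take B in C^2 to consist of the (z1, z2) with Im z2 <> 0 or with Im z1
    in one of the windows ]i, i + 1[, i : nat: two half-spaces Im z2 > 0 and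
    Im z2 < 0 communicating through the windows.  The bundle is trivial over
    each half-space and w is glued by the i-th affine map through window i.

    Only differentiability is assumed of holomorphic maps, so Cauchy's estimate
    is obtained from Goursat's subdivision argument, carried out directly on
    midpoint Riemann sums. *)

Set Implicit Arguments.
Unset Strict Implicit.
Unset Printing Implicit Defensive.

Import Order.TTheory GRing.Theory Num.Theory.
Import numFieldNormedType.Exports.

Local Open Scope classical_set_scope.
Local Open Scope ring_scope.

(** * Modulus of complex numbers *)

Notation Mod := real_modulus.

Section Modulus.
Variable R : realType.
Implicit Types z w : Cplx R.

Definition cplx (x y : R) : Cplx R := Complex x y.
Definition creal (x : R) : Cplx R := Complex x 0.

(** The norm of [Cplx R] takes its values in [Cplx R]; this identity moves estimates to real
    inequalities between moduli, where [lra] and [nra] apply. *)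
Lemma normE z : `|z| = creal (Mod z).
Proof. by case: z. Qed.

Lemma ModE (x y : R) : Mod (cplx x y) = Num.sqrt (x ^+ 2 + y ^+ 2).
Proof. by []. Qed.

Lemma creal_lt (x y : R) : (creal x < creal y) = (x < y).
Proof. by rewrite ltcE /= eqxx. Qed.

Lemma creal_le (x y : R) : (creal x <= creal y) = (x <= y).
Proof. by rewrite lecE /= eqxx. Qed.

Lemma creal_gt0 (e : Cplx R) : 0 < e -> exists2 d : R, 0 < d & e = creal d.
Proof.
by case: e => a b; rewrite ltcE /= => /andP[/eqP -> a0]; exists a.
Qed.

Lemma normlt z (e : R) : (`|z| < creal e) = (Mod z < e).
Proof. by rewrite normE creal_lt. Qed.

Lemma Mod_ge0 z : 0 <= Mod z.
Proof. by have := normr_ge0 z; rewrite normE -[0]/(creal 0) creal_le. Qed.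

Lemma ModD z1 z2 : Mod (z1 + z2) <= Mod z1 + Mod z2.
Proof.
have := ler_normD z1 z2; rewrite !normE.
by rewrite lecE => /andP[_].
Qed.

Lemma ModM z1 z2 : Mod (z1 * z2) = Mod z1 * Mod z2.
Proof. exact: Normc.normcM. Qed.

Lemma ModV z : Mod z^-1 = (Mod z)^-1.
Proof. exact: Normc.normcV. Qed.

Lemma ModN z : Mod (- z) = Mod z.
Proof. by rewrite /Mod normrN. Qed.

Lemma Mod0 : Mod (0 : Cplx R) = 0.
Proof. by rewrite /Mod normr0. Qed.

Lemma Mod_eq0 z : Mod z = 0 -> z = 0.
Proof. by move=> h; apply/normr0_eq0; rewrite normE h. Qed.

Lemma Mod_gt0 z : z != 0 -> 0 < Mod z.
Proof.
by move=> z0; rewrite lt_def Mod_ge0 andbT; apply: contra z0 => /eqP/Mod_eq0 ->.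
Qed.

Lemma Mod_creal (x : R) : Mod (creal x) = `|x|.
Proof. by rewrite /creal -/(cplx _ _) ModE expr0n addr0 sqrtr_sqr. Qed.

Lemma Mod_Re z : `|complex.Re z| <= Mod z.
Proof.
case: z => x y; rewrite -/(cplx x y) ModE -sqrtr_sqr ler_wsqrtr //=.
by rewrite lerDl sqr_ge0.
Qed.

Lemma Mod_Im z : `|complex.Im z| <= Mod z.
Proof.
case: z => x y; rewrite -/(cplx x y) ModE -sqrtr_sqr ler_wsqrtr //=.
by rewrite lerDr sqr_ge0.
Qed.

Lemma Mod_le (x y : R) : Mod (cplx x y) <= `|x| + `|y|.
Proof.
have -> : cplx x y = creal x + cplx 0 1 * creal y.
  rewrite /cplx /creal; apply/eqP; rewrite eq_complex /= !(mul0r, mul1r, mulr0).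
  by apply/andP; split; apply/eqP; ring.
apply: (le_trans (ModD _ _)); rewrite ModM !Mod_creal ModE expr0n expr1n add0r.
by rewrite sqrtr1 mul1r.
Qed.

Lemma Mod_i : Mod (cplx 0 1) = 1.
Proof. by rewrite ModE expr0n expr1n add0r sqrtr1. Qed.

Lemma crealD (a b : R) : creal (a + b) = creal a + creal b.
Proof. by apply/eqP; rewrite eq_complex /= addr0 !eqxx. Qed.

Lemma crealM (a b : R) : creal (a * b) = creal a * creal b.
Proof. by apply/eqP; rewrite eq_complex /= !mulr0 !mul0r subr0 addr0 !eqxx. Qed.

Lemma creal_mulE (a : R) z :
  creal a * z = cplx (a * complex.Re z) (a * complex.Im z).
Proof. by case: z => x y; apply/eqP; rewrite eq_complex /= !mul0r subr0 addr0 !eqxx. Qed.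

Lemma Im_affine (a b : R) z :
  complex.Im (creal a * z + creal b) = a * complex.Im z.
Proof. by rewrite creal_mulE; case: z => p q /=; rewrite addr0. Qed.

Lemma ImD z1 z2 : complex.Im (z1 + z2) = complex.Im z1 + complex.Im z2.
Proof. by case: z1 z2 => ? ? []. Qed.

Lemma Mod_ReB z w : `|complex.Re w - complex.Re z| <= Mod (w - z).
Proof. by apply: le_trans (Mod_Re _); case: z w => ? ? []. Qed.

Lemma Mod_ImB z w : `|complex.Im w - complex.Im z| <= Mod (w - z).
Proof. by apply: le_trans (Mod_Im _); case: z w => ? ? []. Qed.

Lemma cplxV (x y : R) : (cplx x y)^-1 =
  cplx (x / (x ^+ 2 + y ^+ 2)) (- (y / (x ^+ 2 + y ^+ 2))).
Proof. by []. Qed.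

Lemma Mod_sum n (u : 'I_n -> Cplx R) : Mod (\sum_i u i) <= \sum_i Mod (u i).
Proof.
elim/big_ind2: _ => //; first by rewrite Mod0.
by move=> a b c d h1 h2; apply: (le_trans (ModD _ _)); exact: lerD.
Qed.

Lemma nbhsC z (A : set (Cplx R)) :
  nbhs z A <-> exists2 e : R, 0 < e & forall z', Mod (z' - z) < e -> A z'.
Proof.
split=> [/nbhs_ballP[e /creal_gt0[d d0 ->] h]|[e e0 h]].
  by exists d => // z' z'd; apply: h; rewrite /ball /= distrC normlt.
apply/nbhs_ballP; exists (creal e); first by rewrite /= -[0]/(creal 0) creal_lt.
by move=> z'; rewrite /ball /= distrC normlt => /h.
Qed.

End Modulus.
Arguments cplx {R}. Arguments creal {R}.

(** * Bisection of squares *)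

Section Bisection.
Variable R : realType.

(** In each coordinate the intervals [[u n, u n + s / 2 ^+ n]] are nested, so every right end bounds
    all left ends and the supremum of the left ends lies in all of them. *)
Lemma nested_squares (x y : nat -> R) (s : R) : 0 < s ->
  (forall n, x n <= x n.+1 <= x n + s / 2 ^+ n.+1) ->
  (forall n, y n <= y n.+1 <= y n + s / 2 ^+ n.+1) ->
  exists a b, forall n, x n <= a <= x n + s / 2 ^+ n /\ y n <= b <= y n + s / 2 ^+ n.
Proof.
move=> s0.
suff K (u : nat -> R) : (forall n, u n <= u n.+1 <= u n + s / 2 ^+ n.+1) ->
    exists a, forall n, u n <= a <= u n + s / 2 ^+ n.
  by move=> /K[a ha] /K[b hb]; exists a, b.
move=> hu.
have up n : u n.+1 + s / 2 ^+ n.+1 <= u n + s / 2 ^+ n.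
  have /andP[_] := hu n; rewrite exprS invfM; set t := (2 ^+ n)^-1; lra.
have mono n m : u n <= u (n + m)%N.
  elim: m => [|m IH]; first by rewrite addn0.
  by rewrite addnS; apply: (le_trans IH); case/andP: (hu (n + m)%N).
have anti n m : u (n + m)%N + s / 2 ^+ (n + m) <= u n + s / 2 ^+ n.
  elim: m => [|m IH]; first by rewrite addn0.
  by rewrite addnS; apply: (le_trans _ IH); exact: up.
have p n : 0 < s / 2 ^+ n by rewrite divr_gt0 // exprn_gt0.
have bnd n m : u m <= u n + s / 2 ^+ n.
  have := mono m n; have := anti n m; have := p (n + m)%N.
  rewrite (addnC m n); lra.
have ne : range u !=set0 by exists (u 0); exists 0%N.
have hs : has_sup (range u).
  by split => //; exists (u 0%N + s / 2 ^+ 0) => _ [m _ <-]; exact: bnd.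
exists (sup (range u)) => n; apply/andP; split.
  by apply: ub_le_sup; [case: hs | exists n].
by apply: ge_sup => // _ [m _ <-]; exact: bnd.
Qed.

(* A compactness argument: a property of squares that holds on small squares
   and is inherited from the four quarters holds on every square. *)
Lemma square_bisection (P : R -> R -> R -> Prop) (x0 y0 s0 : R) : 0 < s0 ->
  (forall x y s, 0 < s -> P x y (s / 2) -> P (x + s / 2) y (s / 2) ->
     P x (y + s / 2) (s / 2) -> P (x + s / 2) (y + s / 2) (s / 2) -> P x y s) ->
  (forall a b, x0 <= a <= x0 + s0 -> y0 <= b <= y0 + s0 ->
     exists2 d, 0 < d & forall x y s, 0 < s -> s < d -> x <= a <= x + s ->
       y <= b <= y + s -> P x y s) ->
  P x0 y0 s0.
Proof.
move=> s00 glue loc; apply: contrapT => nP.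
pose sz n := s0 / 2 ^+ n.
have szp n : 0 < sz n by rewrite divr_gt0 // exprn_gt0.
have szS n : sz n.+1 = sz n / 2 by rewrite /sz exprSr invfM mulrA mulrAC.
have [u [u0 hu]] : exists u : nat -> R * R, u 0%N = (x0, y0) /\
   forall n, ~ P (u n).1 (u n).2 (sz n) /\
     ((u n).1 <= (u n.+1).1 <= (u n).1 + sz n.+1) /\
     ((u n).2 <= (u n.+1).2 <= (u n).2 + sz n.+1).
  have step n p : ~ P p.1 p.2 (sz n) -> exists q : R * R,
      [/\ ~ P q.1 q.2 (sz n.+1), (p.1 <= q.1 <= p.1 + sz n.+1) &
          (p.2 <= q.2 <= p.2 + sz n.+1)].
    move=> np; apply: contrapT => nq; apply: np.
    have h := szp n.+1.
    have Q q1 q2 : p.1 <= q1 <= p.1 + sz n.+1 -> p.2 <= q2 <= p.2 + sz n.+1 ->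
      P q1 q2 (sz n / 2).
      by move=> h1 h2; apply: contrapT; rewrite -szS => np; apply: nq; exists (q1, q2).
    have [r1 r2] : p.1 <= p.1 <= p.1 + sz n.+1 /\ p.2 <= p.2 <= p.2 + sz n.+1.
      by rewrite !lexx /= !lerDl (ltW h).
    have [r3 r4] : p.1 <= p.1 + sz n / 2 <= p.1 + sz n.+1 /\
                   p.2 <= p.2 + sz n / 2 <= p.2 + sz n.+1.
      by rewrite -szS !lexx !lerDl (ltW h).
    by apply: glue; rewrite ?szp //; apply: Q.
  (* Dependent choice: a state carries its level, its corner and the proof that [P] fails there, so
     that choosing a bad quarter can be iterated. *)
  pose T := {np : nat * (R * R) | ~ P np.2.1 np.2.2 (sz np.1)}.
  have nP0 : ~ P ((0%N, (x0, y0)).2.1) ((0%N, (x0, y0)).2.2) (sz 0) by rewrite /sz expr0 divr1.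
  have stepT (t : T) : {t' : T | (sval t').1 = (sval t).1.+1 /\
      ((sval t).2.1 <= (sval t').2.1 <= (sval t).2.1 + sz (sval t').1) /\
      ((sval t).2.2 <= (sval t').2.2 <= (sval t).2.2 + sz (sval t').1)}.
    apply: cid; case: t => [[n p] np]; have [q [h1 h2 h3]] := step n p np.
    by exists (exist (fun np : nat * (R * R) => ~ P np.2.1 np.2.2 (sz np.1)) (n.+1, q) h1).
  pose v n := iter n (fun t => sval (stepT t))
    (exist (fun np : nat * (R * R) => ~ P np.2.1 np.2.2 (sz np.1)) (0%N, (x0, y0)) nP0).
  have v1 n : (sval (v n)).1 = n.
    by elim: n => // n IH; have [e _] := svalP (stepT (v n)); rewrite [LHS]e IH.
  exists (fun n => (sval (v n)).2); split => // n.
  split; first by have := svalP (v n); rewrite v1.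
  by have [_] := svalP (stepT (v n)); rewrite -[sval (stepT (v n))]/(v n.+1) (v1 n.+1).
have hu1 n := (hu n).1.
have [||a [b hab]] := @nested_squares (fun n => (u n).1) (fun n => (u n).2) s0 s00.
- by move=> n; case: (hu n).2.
- by move=> n; case: (hu n).2.
have := hab 0%N; rewrite u0 /= expr0 divr1 => -[ha hb].
have [d d0 hd] := loc a b ha hb.
have [n hn] : exists n, sz n < d.
  exists (Num.truncn (s0 / d)).+1; rewrite /sz ltr_pdivrMr ?exprn_gt0 //.
  rewrite -ltr_pdivrMl // mulrC; apply: (lt_trans (truncnS_gt _)).
  by rewrite -natrX ltr_nat; exact: ltn_expl.
by case: (hab n) => h1 h2; apply: (hu1 n); exact: hd.
Qed.

End Bisection.

(** * Goursat's lemma for midpoint sums *)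

Section Goursat.
Variable R : realType.
Implicit Types (h : R -> R -> Cplx R) (x y s t : R).

Definition edge_sum N h x y s : Cplx R :=
  \sum_(k < N) h (x + (k%:R + 2^-1) * (s / N%:R)) y * creal (s / N%:R).

(* Midpoint sums for the integral of h(x + i y) (dx + i dy) along the boundary
   of the square with lower left corner x + i y and side s. *)
Definition contour_sum N h x y s : Cplx R :=
  edge_sum N h x y s - edge_sum N h x (y + s) s +
  cplx 0 1 * (edge_sum N (fun a b => h b a) y (x + s) s -
              edge_sum N (fun a b => h b a) y x s).

(** The [2 ^ n.+1] midpoints of an edge are exactly those of its two halves. Subdivision is thus an
    identity between finite sums, and no integral has to be defined. *)
Lemma edge_sum_split n h x y t :
  edge_sum (2 ^ n.+1) h x y (t + t) =
  edge_sum (2 ^ n) h x y t + edge_sum (2 ^ n) h (x + t) y t.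
Proof.
have N0 : ((2 ^ n)%:R : R) != 0 by rewrite pnatr_eq0 -lt0n expn_gt0.
rewrite /edge_sum expnS mul2n -addnn big_split_ord /=.
have -> : (t + t) / (2 ^ n + 2 ^ n)%:R = t / (2 ^ n)%:R :> R.
  rewrite natrD; move: ((2 ^ n)%:R) N0 => N N0; field.
  by rewrite N0 -mulr2n mulrn_eq0 N0.
congr (_ + _); apply: eq_bigr => k _; congr (h _ _ * _).
rewrite natrD -(addrA x); congr (_ + _).
by move: ((2 ^ n)%:R) N0 => N N0; field.
Qed.

(** The edges interior to the large square are traversed twice in opposite directions and cancel. *)
Lemma contour_sum_split n h x y t :
  contour_sum (2 ^ n.+1) h x y (t + t) =
  contour_sum (2 ^ n) h x y t + contour_sum (2 ^ n) h (x + t) y t +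
  (contour_sum (2 ^ n) h x (y + t) t + contour_sum (2 ^ n) h (x + t) (y + t) t).
Proof. by rewrite /contour_sum !edge_sum_split !addrA; ring. Qed.

Lemma edge_sumD N h1 h2 x y s :
  edge_sum N (fun a b => h1 a b + h2 a b) x y s =
  edge_sum N h1 x y s + edge_sum N h2 x y s.
Proof. by rewrite /edge_sum -big_split /=; apply: eq_bigr => k _; rewrite mulrDl. Qed.

Lemma contour_sumD N h1 h2 x y s :
  contour_sum N (fun a b => h1 a b + h2 a b) x y s =
  contour_sum N h1 x y s + contour_sum N h2 x y s.
Proof.
by rewrite /contour_sum !edge_sumD; ring.
Qed.

Lemma edge_sumZ N (c : Cplx R) h x y s :
  edge_sum N (fun a b => c * h a b) x y s = c * edge_sum N h x y s.
Proof. by rewrite /edge_sum mulr_sumr; apply: eq_bigr => k _; rewrite mulrA. Qed.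

Lemma contour_sumZ N (c : Cplx R) h x y s :
  contour_sum N (fun a b => c * h a b) x y s = c * contour_sum N h x y s.
Proof.
by rewrite /contour_sum !edge_sumZ; ring.
Qed.

Lemma edge_sum_cst N (c : Cplx R) x y s : (0 < N)%N ->
  edge_sum N (fun _ _ => c) x y s = c * creal s.
Proof.
move=> N0; rewrite /edge_sum -mulr_sumr; congr (_ * _).
rewrite sumr_const card_ord -[RHS]/(real_complex R s).
rewrite -[creal _]/(real_complex R _) -rmorphMn /=; congr (_ +i* _)%C.
by rewrite -mulr_natr mulfVK // pnatr_eq0 -lt0n.
Qed.

(** On opposite edges the values of [cplx] differ by the constants [i s] and [s], so the horizontal
    pair contributes [- i s ^+ 2] and the vertical pair [i s ^+ 2]. *)
Lemma contour_sum_affine N (c l : Cplx R) x y s : (0 < N)%N ->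
  contour_sum N (fun a b => c + l * cplx a b) x y s = 0.
Proof.
move=> N0; rewrite contour_sumD contour_sumZ.
have -> : contour_sum N (fun _ _ => c) x y s = 0.
  by rewrite /contour_sum !edge_sum_cst //; ring.
rewrite add0r; suff -> : contour_sum N cplx x y s = 0 by rewrite mulr0.
have E1 : edge_sum N cplx x (y + s) s = edge_sum N cplx x y s + cplx 0 s * creal s.
  rewrite -(edge_sum_cst (cplx 0 s) x y s N0) -edge_sumD.
  by apply: eq_bigr => k _; congr (_ * _); apply/eqP; rewrite eq_complex /= ?addr0 !eqxx.
have E2 : edge_sum N (fun a b => cplx b a) y (x + s) s =
   edge_sum N (fun a b => cplx b a) y x s + creal s * creal s.
  rewrite -(edge_sum_cst (creal s) y x s N0) -edge_sumD.
  by apply: eq_bigr => k _; congr (_ * _); apply/eqP; rewrite eq_complex /= ?addr0 !eqxx.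
rewrite /contour_sum E1 E2; have -> : cplx 0 s = cplx 0 1 * creal s.
  by rewrite /cplx; apply/eqP; rewrite eq_complex /=; apply/andP; split; apply/eqP; ring.
ring.
Qed.

Lemma edge_sum_bound N h x y s M : (0 < N)%N -> 0 < s ->
  (forall t, x <= t <= x + s -> Mod (h t y) <= M) ->
  Mod (edge_sum N h x y s) <= s * M.
Proof.
move=> N0 s0 hM; apply: (le_trans (Mod_sum _)).
have NR : (0 : R) < N%:R by rewrite ltr0n.
have : forall k : 'I_N, true ->
    Mod (h (x + (k%:R + 2^-1) * (s / N%:R)) y * creal (s / N%:R)) <= M * (s / N%:R).
  move=> k _; rewrite ModM Mod_creal ger0_norm; last by rewrite divr_ge0 // ltW.
  apply: ler_wpM2r; first by rewrite divr_ge0 // ltW.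
  have k0 : (0 : R) <= k%:R by [].
  apply: hM; apply/andP; split.
    by rewrite lerDl mulr_ge0 ?divr_ge0 ?(ltW s0) ?ler0n //; lra.
  rewrite lerD2l mulrCA -[leRHS]mulr1 ler_pM2l // ler_pdivrMr // mul1r.
  have : (k%:R + 1 : R) <= N%:R by rewrite natr1 ler_nat.
  lra.
move=> /ler_sum /le_trans; apply; rewrite sumr_const. rewrite card_ord -[leLHS]mulr_natr.
by rewrite -mulrA mulfVK ?gt_eqF // mulrC.
Qed.

Lemma contour_sum_bound N h x y s M : (0 < N)%N -> 0 < s ->
  (forall a b, x <= a <= x + s -> y <= b <= y + s ->
     [\/ a = x, a = x + s, b = y | b = y + s] -> Mod (h a b) <= M) ->
  Mod (contour_sum N h x y s) <= 4 * s * M.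
Proof.
move=> N0 s0 hM; rewrite /contour_sum.
have xs : x <= x + s by rewrite lerDl ltW.
have ys : y <= y + s by rewrite lerDl ltW.
apply: (le_trans (ModD _ _)); rewrite ModM Mod_i mul1r.
have -> : 4 * s * M = (s * M + s * M) + (s * M + s * M) by ring.
apply: lerD; apply: (le_trans (ModD _ _)); rewrite ModN; apply: lerD;
  apply: edge_sum_bound => // t ht; apply: hM; rewrite ?lexx ?xs ?ys //.
- by constructor 3.
- by constructor 4.
- by constructor 2.
- by constructor 1.
Qed.

(** Complex differentiability in real coordinates, with the error measured by the sum of the
    coordinate distances, which is convenient on squares. *)
Definition holo_at h a b := exists l : Cplx R, forall e : R, 0 < e ->
  exists2 d : R, 0 < d & forall x y, `|x - a| < d -> `|y - b| < d ->
    Mod (h x y - h a b - l * cplx (x - a) (y - b)) <= e * (`|x - a| + `|y - b|).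

(** The bound [e * s ^+ 2] is additive under quartering, so bisection reduces it to small squares.
    There the affine part of [h] contributes nothing and the remainder is controlled by
    differentiability. *)
Lemma goursat h x y s : 0 < s ->
  (forall a b, x <= a <= x + s -> y <= b <= y + s -> holo_at h a b) ->
  forall e, 0 < e -> exists K, forall n, (K <= n)%N ->
    Mod (contour_sum (2 ^ n) h x y s) <= e * s ^+ 2.
Proof.
move=> s0 dh e e0.
apply: (@square_bisection R (fun x y s => exists K, forall n, (K <= n)%N ->
    Mod (contour_sum (2 ^ n) h x y s) <= e * s ^+ 2)) => //.
  move=> {dh s0}{x}x {y}y {s}s s0 [K1 h1] [K2 h2] [K3 h3] [K4 h4].
  (* Level [n.+1] on the square is level [n] on its quarters, whence the successor. *)
  exists (maxn (maxn K1 K2) (maxn K3 K4)).+1 => -[//|n].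
  rewrite ltnS !geq_max => /andP[/andP[n1 n2] /andP[n3 n4]].
  rewrite {1}(splitr s) contour_sum_split.
  have -> : e * s ^+ 2 = (e * (s / 2) ^+ 2 + e * (s / 2) ^+ 2) +
     (e * (s / 2) ^+ 2 + e * (s / 2) ^+ 2) by field.
  apply: (le_trans (ModD _ _)); apply: lerD; apply: (le_trans (ModD _ _));
    apply: lerD; auto.
move=> a b ha hb; have [l hl] := dh a b ha hb.
have [|d d0 hd] := hl (e / 8); first by rewrite divr_gt0.
exists d => // {dh ha hb s0}{x}x {y}y {s}s s0 sd ha hb; exists 0%N => n _.
have N0 : (0 < 2 ^ n)%N by rewrite expn_gt0.
pose g u v := h u v - h a b - l * cplx (u - a) (v - b).
have hE : h = fun u v => g u v + (h a b - l * cplx a b + l * cplx u v).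
  apply/funext => u; apply/funext => v; rewrite /g.
  have -> : cplx (u - a) (v - b) = cplx u v - cplx a b by [].
  by ring.
rewrite hE contour_sumD contour_sum_affine // addr0.
(* Perimeter [4 * s] times the bound for the error, both coordinate distances being at most [s]. *)
have -> : e * s ^+ 2 = 4 * s * (e / 8 * (s + s)) by field.
apply: contour_sum_bound => // u v hu hv _; rewrite /g.
have us : `|u - a| <= s.
  move/andP: hu => [? ?]; move/andP: ha => [? ?]; rewrite ler_norml; apply/andP; split; lra.
have vs : `|v - b| <= s.
  move/andP: hv => [? ?]; move/andP: hb => [? ?]; rewrite ler_norml; apply/andP; split; lra.
apply: (le_trans (hd _ _ (le_lt_trans us sd) (le_lt_trans vs sd))).
by rewrite ler_wpM2l ?lerD // ltW // divr_gt0.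
Qed.

(** Cut the large square into sixteen squares of side [u]. The four central ones form the inner
    square; the other twelve avoid the origin, and Goursat's lemma bounds each of them by
    [e / 12]. *)
Lemma goursat_annulus h u : 0 < u ->
  (forall a b, `|a| <= u + u -> `|b| <= u + u -> a != 0 \/ b != 0 -> holo_at h a b) ->
  forall e, 0 < e -> exists K, forall n, (K <= n)%N ->
    Mod (contour_sum (2 ^ n.+2) h (- (u + u)) (- (u + u)) (u + u + (u + u))) <=
    Mod (contour_sum (2 ^ n.+1) h (- u) (- u) (u + u)) + e.
Proof.
move=> u0 dh e e0.
have E n x y : contour_sum (2 ^ n.+2) h x y (u + u + (u + u)) =
   contour_sum (2 ^ n.+1) h (x + u) (y + u) (u + u) +
   ((contour_sum (2 ^ n) h x y u + contour_sum (2 ^ n) h (x + u) y u +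
   (contour_sum (2 ^ n) h (x + u + u) y u + contour_sum (2 ^ n) h (x + u + u + u) y u)) +
   (contour_sum (2 ^ n) h x (y + u) u + contour_sum (2 ^ n) h (x + u + u + u) (y + u) u +
   (contour_sum (2 ^ n) h x (y + u + u) u + contour_sum (2 ^ n) h (x + u + u + u) (y + u + u) u)) +
   (contour_sum (2 ^ n) h x (y + u + u + u) u + contour_sum (2 ^ n) h (x + u) (y + u + u + u) u +
   (contour_sum (2 ^ n) h (x + u + u) (y + u + u + u) u +
    contour_sum (2 ^ n) h (x + u + u + u) (y + u + u + u) u))).
  pose f m := contour_sum (2 ^ m) h.
  have S m x' y' t : f m.+1 x' y' (t + t) = f m x' y' t + f m (x' + t) y' t +
    (f m x' (y' + t) t + f m (x' + t) (y' + t) t) by exact: contour_sum_split.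
  rewrite -/(f n.+2) -/(f n.+1) -/(f n).
  by move: f S => f S; rewrite !S !addrA; ring.
have G x y : - (u + u) <= x -> x + u <= u + u -> - (u + u) <= y -> y + u <= u + u ->
    [|| 0 < x, x + u < 0, 0 < y | y + u < 0] ->
    \forall n \near \oo, Mod (contour_sum (2 ^ n) h x y u) <= e / 12.
  move=> x1 x2 y1 y2 off.
  have [a b /andP[a1 a2] /andP[b1 b2]||K hK] := @goursat h x y u u0 _ (e / 12 / u ^+ 2).
  - apply: dh; rewrite ?ler_norml; first by apply/andP; split; lra.
      by apply/andP; split; lra.
    case/or4P: off => ?; [left|left|right|right]; rewrite neq_lt; apply/orP.
    + by right; lra.
    + by left; lra.
    + by right; lra.
    + by left; lra.
  - by rewrite !divr_gt0 // exprn_gt0.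
  exists K => // n /hK; rewrite mulfVK // expf_neq0 // gt_eqF //.
have C n' : contour_sum n' h (- (u + u) + u) (- (u + u) + u) (u + u) =
    contour_sum n' h (- u) (- u) (u + u) by congr contour_sum; ring.
have e12 : e = (e / 12 + e / 12 + (e / 12 + e / 12)) + (e / 12 + e / 12 + (e / 12 + e / 12)) +
  (e / 12 + e / 12 + (e / 12 + e / 12)) by field.
suff [K _ hK] : \forall n \near \oo,
    Mod (contour_sum (2 ^ n.+2) h (- (u + u)) (- (u + u)) (u + u + (u + u))) <=
    Mod (contour_sum (2 ^ n.+1) h (- u) (- u) (u + u)) + e by exists K => n /hK.
near=> n; rewrite E C {1}e12.
apply: (le_trans (ModD _ _)); rewrite lerD2l.
by do ?[apply: (le_trans (ModD _ _)); apply: lerD]; near: n; apply: G; lra.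
Unshelve. all: by end_near. Qed.

End Goursat.

(** * Cauchy's estimate *)

Section Cauchy.
Variable R : realType.
Implicit Types (F : Cplx R -> Cplx R) (z l : Cplx R).

Lemma derivable_approx F z : derivable F z 1 -> forall e : R, 0 < e ->
  exists2 d : R, 0 < d & forall w : Cplx R, Mod (w - z) < d ->
    Mod (F w - F z - 'D_1 F z * (w - z)) <= e * Mod (w - z).
Proof.
move=> /derivableP[dF DF] e e0.
have /cvgr_dist_lt/(_ (creal e)) : (h^-1 *: (F (h *: 1 + z) - F z)) @[h --> 0^'] --> 'D_1 F z.
  exact: dF.
rewrite -[0 < creal e]/(creal 0 < creal e) creal_lt => /(_ e0).
rewrite /prop_near1 /dnbhs /within /= => /nbhsC[d d0 hd].
exists d => // w wd; have [->|wz] := eqVneq w z.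
  by rewrite !subrr mulr0 subr0 Mod0 mulr0.
have wz0 : w - z != 0 by rewrite subr_eq0.
have /hd H : Mod (w - z - 0) < d by rewrite subr0.
have := H wz0; rewrite normlt.
rewrite [(w - z) *: 1]mulr1 subrK => /ltW.
rewrite -(ler_pM2r (Mod_gt0 wz0)) -ModM; apply: le_trans.
rewrite -ModN opprB le_eqVlt; apply/orP; left; apply/eqP; congr Mod.
by rewrite [_^-1 *: _]mulrC mulrBl mulfVK.
Qed.

Lemma holo_at_derivable F (a b : R) : derivable F (cplx a b) 1 ->
  holo_at (fun x y => F (cplx x y)) a b.
Proof.
move=> dF; exists ('D_1 F (cplx a b)) => e e0.
have [d d0 hd] := derivable_approx dF e0.
exists (d / 2) => [|x y xa yb]; first by rewrite divr_gt0.
have E : cplx (x - a) (y - b) = cplx x y - cplx a b by [].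
rewrite E; have := hd (cplx x y); rewrite -E => H.
apply: (le_trans (H _)); last by rewrite ler_wpM2l ?Mod_le // ltW.
by apply: (le_lt_trans (Mod_le _ _)); lra.
Qed.

Lemma edge_sum_Im N (h : R -> R -> Cplx R) (x y s m : R) : (0 < N)%N -> 0 < s ->
  (forall t, x <= t <= x + s -> m <= complex.Im (h t y)) ->
  s * m <= complex.Im (edge_sum N h x y s).
Proof.
move=> N0 s0 hM; have NR : (0 : R) < N%:R by rewrite ltr0n.
have -> : complex.Im (edge_sum N h x y s) =
   \sum_(k < N) complex.Im (h (x + (k%:R + 2^-1) * (s / N%:R)) y) * (s / N%:R).
  rewrite /edge_sum; elim/big_ind2: _ => // [u1 u2 v1 v2 <- <-|k _]; first exact: ImD.
  by case: (h _ _) => p q /=; rewrite mulr0 add0r.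
have -> : s * m = \sum_(k < N) m * (s / N%:R).
  rewrite sumr_const card_ord -[RHS]mulr_natr -mulrA mulfVK ?gt_eqF //.
  by rewrite mulrC.
apply: ler_sum => k _; apply: ler_wpM2r; first by rewrite divr_ge0 // ltW.
have k0 : (0 : R) <= k%:R by [].
apply: hM; apply/andP; split.
  by rewrite lerDl mulr_ge0 ?divr_ge0 ?(ltW s0) ?ler0n //; lra.
rewrite lerD2l mulrCA -[leRHS]mulr1 ler_pM2l // ler_pdivrMr // mul1r.
have : (k%:R + 1 : R) <= N%:R by rewrite natr1 ler_nat.
lra.
Qed.

(* A lower bound for the modulus of the integral of dz / z, which is 2 i pi. *)
Lemma contour_sum_inv N (r : R) : (0 < N)%N -> 0 < r ->
  4 <= Mod (contour_sum N (fun x y => (cplx x y)^-1) (- r) (- r) (r + r)).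
Proof.
move=> N0 r0; apply: (le_trans _ (Mod_Im _)); apply: (le_trans _ (ler_norm _)).
have s0 : 0 < r + r by rewrite addr_gt0.
rewrite /contour_sum; have -> : - r + (r + r) = r by ring.
set h := fun x y => (cplx x y)^-1.
have -> : edge_sum N h (- r) (- r) (r + r) - edge_sum N h (- r) r (r + r) +
  cplx 0 1 * (edge_sum N (fun a b => h b a) (- r) r (r + r) -
              edge_sum N (fun a b => h b a) (- r) (- r) (r + r)) =
  (edge_sum N h (- r) (- r) (r + r) + edge_sum N (fun a b => -1 * h a b) (- r) r (r + r)) +
  (edge_sum N (fun a b => cplx 0 1 * h b a) (- r) r (r + r) +
   edge_sum N (fun a b => - cplx 0 1 * h b a) (- r) (- r) (r + r)).
  by rewrite !edge_sumZ; ring.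
(* Each of the four edges has length [2 * r] and carries an integrand of imaginary part at least
   [(2 * r)^-1], so each contributes at least 1. *)
rewrite !ImD; have -> : 4 = ((r + r) * (2 * r)^-1 + (r + r) * (2 * r)^-1) +
   ((r + r) * (2 * r)^-1 + (r + r) * (2 * r)^-1).
  by field; rewrite gt_eqF.
have K t : - r <= t <= - r + (r + r) -> (2 * r)^-1 <= r / (t ^+ 2 + r ^+ 2).
  move=> /andP[t1 t2]; have tr : 0 <= (r - t) * (r + t) by apply: mulr_ge0; lra.
  have rr : 0 < r ^+ 2 by rewrite exprn_gt0.
  rewrite ler_pdivlMr; last by have := sqr_ge0 t; lra.
  by rewrite mulrC ler_pdivrMr ?mulr_gt0 //; lra.
apply: lerD; apply: lerD; apply: edge_sum_Im => // t /K; rewrite /h !cplxV /=.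
- by rewrite sqrrN mulNr opprK.
- by rewrite ?(mul0r, mulN1r, mulNr, opprK, oppr0, addr0, add0r, mul1r, subr0).
- by rewrite [r ^+ 2 + _]addrC ?(mul0r, mulN1r, mulNr, opprK, oppr0, addr0, add0r, mul1r, subr0).
- by rewrite sqrrN [r ^+ 2 + _]addrC
    ?(mul0r, mulN1r, mulNr, mulrN, opprK, oppr0, addr0, add0r, mul1r, subr0).
Qed.

(** Iterates [goursat_annulus] over [m] doublings of the square. The allowance [e] is halved at each
    step, so the accumulated errors stay below [e]. *)
Lemma small_contour_sum (h : R -> R -> Cplx R) (u c : R) m : 0 < u ->
  (forall a b, `|a| <= u *+ 2 ^ m -> `|b| <= u *+ 2 ^ m -> a != 0 \/ b != 0 -> holo_at h a b) ->
  (exists K, forall n, (K <= n)%N ->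
    Mod (contour_sum (2 ^ n) h (- u) (- u) (u + u)) <= c) ->
  forall e, 0 < e -> exists K, forall n, (K <= n)%N ->
    Mod (contour_sum (2 ^ n) h (- (u *+ 2 ^ m)) (- (u *+ 2 ^ m))
           (u *+ 2 ^ m + u *+ 2 ^ m)) <= c + e.
Proof.
move=> u0; elim: m => [|m IH] dh S e e0.
  case: S => K hK; exists K => n /hK; rewrite expn0 mulr1n => /le_trans; apply.
  by rewrite lerDl ltW.
have um : 0 < u *+ 2 ^ m by rewrite pmulrn_lgt0 // expn_gt0.
have E : u *+ 2 ^ m.+1 = u *+ 2 ^ m + u *+ 2 ^ m by rewrite expnS mul2n -addnn mulrnDr.
have [||K1 h1] := IH _ S (e / 2); last first.
- have [||K2 h2] := @goursat_annulus _ h _ um _ (e / 2); last first.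
  + exists (maxn K1 K2).+2 => -[|[|n]] //; rewrite !ltnS geq_max => /andP[n1 n2].
    rewrite E; apply: (le_trans (h2 _ n2)); have := h1 n.+1 (leqW n1); lra.
  + by rewrite divr_gt0.
  + by move=> a b; rewrite -E; exact: dh.
- by rewrite divr_gt0.
- by move=> a b ha hb; apply: dh; rewrite E -[leLHS]addr0; apply: lerD => //; apply: ltW.
Qed.

(* Goursat's lemma reduces the contour sums of g = (F - F 0 - F'(0) z) / z^2 over
   a large square to those over a small one, where they are small because
   z g z tends to 0; hence F'(0) is determined by the sums of (F - F 0) / z^2. *)
Lemma cauchy_estimate F (r M : R) : 0 < r ->
  (forall a b, `|a| <= r -> `|b| <= r -> derivable F (cplx a b) 1) ->
  (forall a b, `|a| <= r -> `|b| <= r -> Mod (F (cplx a b)) <= M) ->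
  Mod ('D_1 F 0) <= 4 * M / r.
Proof.
move=> r0 dF FM; set l := 'D_1 F 0.
pose G z := F z - F 0.
pose g z := G z * (z^-1 * z^-1) - l * z^-1.
have M0 : 0 <= M by apply: (le_trans (Mod_ge0 (F 0))); apply: (FM 0 0); rewrite normr0 ltW.
have dg a b : `|a| <= r -> `|b| <= r -> a != 0 \/ b != 0 ->
    holo_at (fun x y => g (cplx x y)) a b.
  move=> ha hb ab; apply: holo_at_derivable.
  have z0 : cplx a b != 0.
    by rewrite eq_complex /= negb_and; apply/orP.
  have dV : derivable (fun z => z^-1) (cplx a b) 1.
    by apply: derivableV => //; exact: derivable_id.
  have -> : g = ((F - cst (F 0)) * ((fun z => z^-1) * (fun z => z^-1)) -
                 cst l * (fun z => z^-1)) by apply/funext.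
  have d1 : derivable (F - cst (F 0)) (cplx a b) 1.
    by apply: derivableB; [exact: dF | exact: derivable_cst].
  have d2 := derivableM dV dV.
  exact: derivableB (derivableM d1 d2) (derivableM (derivable_cst l _ _) dV).
apply/ler_addgt0Pr => e e0.
have r0' : `|0 : R| <= r by rewrite normr0 ltW.
have e8 : 0 < e / 8 by rewrite divr_gt0.
have [d d0 hd] := @derivable_approx F 0 (dF 0 0 r0' r0') (e / 8) e8.
have [m hm] : exists m : nat, r / 2 ^+ m < d / 2.
  exists (Num.truncn (r / (d / 2))).+1.
  have d2 : 0 < d / 2 by rewrite divr_gt0.
  rewrite ltr_pdivrMr ?exprn_gt0 //.
  rewrite -ltr_pdivrMl // mulrC; apply: (lt_trans (truncnS_gt _)).
  by rewrite -natrX ltr_nat; exact: ltn_expl.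
pose u := r / 2 ^+ m.
have u0 : 0 < u by rewrite divr_gt0 // exprn_gt0.
have ur : u *+ 2 ^ m = r by rewrite -mulr_natr natrX mulfVK // expf_neq0.
have bdry (t a b : R) : 0 < t -> - t <= a <= - t + (t + t) -> - t <= b <= - t + (t + t) ->
    [\/ a = - t, a = - t + (t + t), b = - t | b = - t + (t + t)] ->
    [/\ `|a| <= t, `|b| <= t & t <= Mod (cplx a b)].
  have -> : - t + (t + t) = t by ring.
  move=> t0 ha hb hab; rewrite !ler_norml ha hb; split => //.
  case: hab => hh; [apply: (le_trans _ (Mod_Re _))|apply: (le_trans _ (Mod_Re _))|
    apply: (le_trans _ (Mod_Im _))|apply: (le_trans _ (Mod_Im _))];
    by rewrite /= hh ?normrN ger0_norm // ltW.
have [||K hK] := @small_contour_sum (fun x y => g (cplx x y)) u e m u0 _ _ e e0.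
- by rewrite ur.
- exists 0%N => n _.
  (* On the small boundary the modulus of [g z] is at most [e / 8] divided by that of [z], which is
     at least [u]; the perimeter is [4 * (u + u)]. *)
  have -> : e = 4 * (u + u) * (e / 8 / u) by field; rewrite gt_eqF.
  apply: contour_sum_bound; rewrite ?expn_gt0 ?addr_gt0 // => a b ha hb hab.
  have [au bu uz] := bdry u a b u0 ha hb hab.
  have z0 : 0 < Mod (cplx a b) by apply: lt_le_trans uz.
  have zN0 : cplx a b != 0 by apply/eqP => zz; move: z0; rewrite zz Mod0 ltxx.
  have -> : g (cplx a b) = (F (cplx a b) - F 0 - l * (cplx a b - 0)) *
      ((cplx a b)^-1 * (cplx a b)^-1).
    by rewrite /g /G subr0; field.
  rewrite !ModM ModV.
  have zd : Mod (cplx a b - 0) < d.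
    rewrite subr0; apply: (le_lt_trans (Mod_le _ _)); move: hm; rewrite -/u; lra.
  apply: (@le_trans _ _ (e / 8 * Mod (cplx a b) * ((Mod (cplx a b))^-1 * (Mod (cplx a b))^-1))).
    apply: ler_wpM2r; first by rewrite mulr_ge0 // invr_ge0 ltW.
    by have := hd _ zd; rewrite {2}subr0.
  rewrite mulrA mulfK ?gt_eqF //; apply: ler_wpM2l; first by rewrite divr_ge0 // ltW.
  by rewrite lef_pV2 // posrE.
have := hK K (leqnn _); rewrite ur => TK.
have N0 : (0 < 2 ^ K)%N by rewrite expn_gt0.
have Tl := contour_sum_inv N0 r0.
have TG : Mod (contour_sum (2 ^ K)
    (fun x y => G (cplx x y) * ((cplx x y)^-1 * (cplx x y)^-1)) (- r) (- r) (r + r)) <=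
    4 * (r + r) * ((M + M) * (r^-1 * r^-1)).
  apply: contour_sum_bound; rewrite ?addr_gt0 // => a b ha hb hab.
  have [ar br rz] := bdry r a b r0 ha hb hab.
  rewrite !ModM ModV; apply: ler_pM; rewrite ?Mod_ge0 ?mulr_ge0 ?invr_ge0 ?Mod_ge0 //.
    apply: (le_trans (ModD _ _)); rewrite ModN; apply: lerD; first exact: FM.
    by apply: (FM 0 0); rewrite normr0 ltW.
  have iz : (Mod (cplx a b))^-1 <= r^-1 by rewrite lef_pV2 // posrE (lt_le_trans r0).
  by apply: ler_pM; rewrite ?invr_ge0 ?Mod_ge0.
have E : contour_sum (2 ^ K)
    (fun x y => G (cplx x y) * ((cplx x y)^-1 * (cplx x y)^-1)) (- r) (- r) (r + r) =
  contour_sum (2 ^ K) (fun x y => g (cplx x y)) (- r) (- r) (r + r) +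
  l * contour_sum (2 ^ K) (fun x y => (cplx x y)^-1) (- r) (- r) (r + r).
  rewrite -contour_sumZ -contour_sumD; congr contour_sum.
  by apply/funext => x; apply/funext => y; rewrite /g subrK.
set T1 := contour_sum _ (fun x y => (cplx x y)^-1) _ _ _ in Tl E.
set T2 := contour_sum _ _ _ _ _ in TK E.
(* The sum of [g] is at most [e + e], and that of [G z / z ^ 2] at most the perimeter [8 * r] times
   [2 * M / r ^+ 2]. Dividing by the lower bound 4 for [T1] gives the claim. *)
have : Mod (l * T1) <= 4 * (r + r) * ((M + M) * (r^-1 * r^-1)) + (e + e).
  have -> : l * T1 = (T2 + l * T1) - T2 by ring.
  by rewrite -E; apply: (le_trans (ModD _ _)); rewrite ModN; apply: lerD.
have -> : 4 * (r + r) * ((M + M) * (r^-1 * r^-1)) = 4 * (4 * M / r).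
  by field; rewrite gt_eqF.
have : Mod l * 4 <= Mod (l * T1) by rewrite ModM ler_wpM2l ?Mod_ge0.
lra.
Qed.

End Cauchy.

(** * Derivative bound for maps into the upper half-plane *)

Section HalfPlane.
Variable R : realType.

(** Apply Cauchy's estimate to the inverse of [G = F - c], where [c] is the conjugate of [F 0].
    Since [Im G = Im F + y >= y], the inverse is bounded by [y^-1]; since [G 0 = 2 i y], its
    derivative at 0 is that of [F] up to a factor of modulus [(4 * y ^+ 2)^-1]. *)
Lemma half_plane_estimate (F : Cplx R -> Cplx R) (r : R) : 0 < r ->
  (forall a b, `|a| <= r -> `|b| <= r -> derivable F (cplx a b) 1) ->
  (forall a b, `|a| <= r -> `|b| <= r -> 0 < complex.Im (F (cplx a b))) ->
  Mod ('D_1 F 0) <= 16 * complex.Im (F 0) / r.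
Proof.
move=> r0 dF FI; set y := complex.Im (F 0).
have r0' : `|0 : R| <= r by rewrite normr0 ltW.
have y0 : 0 < y by exact: (FI 0 0).
pose c := cplx (complex.Re (F 0)) (- y).
pose G := F - cst c.
have ImG z : complex.Im (G z) = complex.Im (F z) + y.
  rewrite -[G z]/(F z - c) /c.
  by case: (F z) => p q /=; rewrite opprK.
have Gy a b : `|a| <= r -> `|b| <= r -> y <= Mod (G (cplx a b)).
  move=> ha hb; apply: (le_trans _ (Mod_Im _)); apply: (le_trans _ (ler_norm _)).
  by rewrite ImG lerDr ltW // FI.
have Gn0 a b : `|a| <= r -> `|b| <= r -> G (cplx a b) != 0.
  move=> ha hb; apply/eqP => h; have := Gy a b ha hb.
  by rewrite h Mod0 leNgt y0.
have dG a b : `|a| <= r -> `|b| <= r -> derivable G (cplx a b) 1.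
  by move=> ha hb; apply: derivableB; [exact: dF | exact: derivable_cst].
have := @cauchy_estimate R (fun z => (G z)^-1) r y^-1 r0.
have -> : 'D_1 (fun z => (G z)^-1) 0 = - (G 0) ^- 2 * 'D_1 F 0.
  rewrite deriveV; [|exact: (Gn0 0 0)|exact: (dG 0 0)].
  rewrite deriveB; [|exact: (dF 0 0)|exact: derivable_cst].
  by rewrite derive_cst subr0.
have G0 : Mod (- (G 0) ^- 2) = (4 * y ^+ 2)^-1.
  rewrite ModN ModV; congr (_^-1).
  have -> : G 0 = cplx 0 1 * creal (y + y).
    rewrite -[G 0]/(F 0 - c) /c /y; case: (F 0) => p q.
    apply/eqP; rewrite eq_complex /=; apply/andP; split; apply/eqP; ring.
  rewrite expr2 !ModM Mod_i Mod_creal !mul1r ger0_norm ?addr_ge0 ?ltW //; ring.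
rewrite ModM G0 => H.
have {}H : (4 * y ^+ 2)^-1 * Mod ('D_1 F 0) <= 4 * y^-1 / r.
  apply: H => a b ha hb.
    by apply: derivableV; [exact: Gn0 | exact: dG].
  by rewrite ModV lef_pV2 ?posrE ?Gy // (lt_le_trans y0) // Gy.
have y2 : 0 < 4 * y ^+ 2 by rewrite mulr_gt0 // exprn_gt0.
move: H; rewrite -(ler_pM2l y2) mulrA mulfV ?gt_eqF // mul1r => /le_trans; apply.
by rewrite le_eqVlt; apply/orP; left; apply/eqP; field; rewrite !gt_eqF.
Qed.

End HalfPlane.

(** * The flat bundle *)

(* The pair m stands for the map w |-> m.1 w + m.2. *)
Section AffineMaps.
Variable R : realType.
Implicit Types m n p : R * R.

Definition acomp m n := (m.1 * n.1, m.1 * n.2 + m.2).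
Definition ainv m := (m.1^-1, - (m.2 / m.1)).

Lemma acompA m n p : acomp m (acomp n p) = acomp (acomp m n) p.
Proof. by rewrite /acomp /=; congr (_, _); ring. Qed.

Lemma acompK m n : 0 < n.1 -> acomp (acomp m n) (ainv n) = m.
Proof.
case: m n => a b [c d] /= c0; rewrite /acomp /ainv /=.
by congr (_, _); field; rewrite gt_eqF.
Qed.

Lemma acompVK m n : 0 < n.1 -> acomp (acomp m (ainv n)) n = m.
Proof.
case: m n => a b [c d] /= c0; rewrite /acomp /ainv /=.
by congr (_, _); field; rewrite gt_eqF.
Qed.

Lemma acompV m : 0 < m.1 -> acomp (ainv m) m = (1, 0).
Proof.
move=> m0; rewrite /acomp /ainv /= mulVf ?gt_eqF //.
by congr (_, _); field; rewrite gt_eqF.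
Qed.

Lemma acompNV m : 0 < m.1 -> acomp m (ainv m) = (1, 0).
Proof.
move=> m0; rewrite /acomp /ainv /= mulfV ?gt_eqF //.
by congr (_, _); field; rewrite gt_eqF.
Qed.

Lemma acomp1 m : acomp (1, 0) m = m.
Proof. by case: m => a b; rewrite /acomp /= !mul1r addr0. Qed.

Lemma acomp_gt0 m n : 0 < m.1 -> 0 < n.1 -> 0 < (acomp m n).1.
Proof. exact: mulr_gt0. Qed.

Lemma ainv_gt0 m : 0 < m.1 -> 0 < (ainv m).1.
Proof. by rewrite invr_gt0. Qed.

Lemma acompI m n p : 0 < p.1 -> acomp m p = acomp n p -> m = n.
Proof. by move=> p0 e; rewrite -(acompK m p0) e acompK. Qed.

End AffineMaps.

(** * Total space, charts and topology of the bundle *)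

Section Bundle.
Variable R : realType.
Notation C := (Cplx R).
Notation V := ('rV[C]_3).
Implicit Types (p q : V) (m : R * R).

Definition o0 : 'I_3 := @Ordinal 3 0 isT.
Definition o1 : 'I_3 := @Ordinal 3 1 isT.
Definition o2 : 'I_3 := @Ordinal 3 2 isT.

Lemma nbhsV p (A : set V) : nbhs p A <->
  exists2 e : R, 0 < e & forall q, (forall j : 'I_3, Mod (q 0 j - p 0 j) < e) -> A q.
Proof.
split=> [/nbhs_ballP[e /creal_gt0[d d0 ->] h]|[e e0 h]].
  exists d => // q qd; apply: h; split; first by rewrite -[0]/(creal 0) creal_lt.
  by move=> k j; rewrite (ord1 k) /ball /= distrC normlt.
apply/nbhs_ballP; exists (creal e); first by rewrite /= -[0]/(creal 0) creal_lt.
by move=> q [_ hq]; apply: h => j; have := hq 0 j; rewrite /ball /= distrC normlt.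
Qed.

Lemma nbhsVI p (A B : set V) : nbhs p A -> nbhs p B -> nbhs p (A `&` B).
Proof. exact: (@filterI _ (nbhs p) (nbhs_filter p)). Qed.

Lemma nbhsVS p (A B : set V) : A `<=` B -> nbhs p A -> nbhs p B.
Proof. exact: (@filterS _ (nbhs p) (nbhs_filter p)). Qed.

Lemma open_coord (P : C -> Prop) (j : 'I_3) :
  (forall z, P z -> exists2 e : R, 0 < e & forall w, Mod (w - z) < e -> P w) ->
  open [set p : V | P (p 0 j)].
Proof.
move=> hP; rewrite openE => p /= /hP[e e0 he]; apply/nbhsV.
by exists e => // q hq; apply: he.
Qed.

Lemma open_Im_gt (j : 'I_3) (c : R) : open [set p : V | c < complex.Im (p 0 j)].
Proof.
apply: (@open_coord (fun z => c < complex.Im z)) => z cz.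
exists (complex.Im z - c) => [|w]; first by rewrite subr_gt0.
move=> /(le_lt_trans (Mod_ImB _ _)); rewrite ltr_norml => /andP[]; lra.
Qed.

Lemma open_Im_lt (j : 'I_3) (c : R) : open [set p : V | complex.Im (p 0 j) < c].
Proof.
apply: (@open_coord (fun z => complex.Im z < c)) => z cz.
exists (c - complex.Im z) => [|w]; first by rewrite subr_gt0.
move=> /(le_lt_trans (Mod_ImB _ _)); rewrite ltr_norml => /andP[]; lra.
Qed.

Definition im1 p : R := complex.Im (p 0 o0).
Definition im2 p : R := complex.Im (p 0 o1).
Definition in_half_plane p : Prop := 0 < complex.Im (p 0 o2).
Definition window (i : nat) p : Prop := i%:R < im1 p < i.+1%:R.
Definition in_chart i p : Prop := im2 p != 0 \/ window i p.

Lemma open_in_half_plane : open in_half_plane.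
Proof. exact: open_Im_gt. Qed.

Lemma open_window i : open (window i).
Proof.
have -> : window i = [set p | i%:R < im1 p] `&` [set p | im1 p < i.+1%:R].
  by apply/seteqP; split => p; [move=> /andP[]|move=> [/= h1 h2]; apply/andP].
by apply: openI; [exact: open_Im_gt | exact: open_Im_lt].
Qed.

Lemma open_in_chart i : open (in_chart i).
Proof.
have -> : in_chart i = ([set p | 0 < im2 p] `|` [set p | im2 p < 0]) `|` window i.
  apply/seteqP; split => p.
    by move=> [|]; [rewrite neq_lt => /orP[]; left; [right|left]|right].
  by move=> [[]|] /= h; [left; rewrite gt_eqF|left; rewrite lt_eqF|right].
apply: openU; last exact: open_window.
by apply: openU; [exact: open_Im_gt | exact: open_Im_lt].
Qed.

Lemma window_inj (i j : nat) p : window i p -> window j p -> i = j.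
Proof.
move=> /andP[i1 i2] /andP[j1 j2].
have := lt_trans i1 j2; have := lt_trans j1 i2.
by rewrite !ltr_nat !ltnS => h1 h2; apply/eqP; rewrite eqn_leq h1 h2.
Qed.

(** The windows are disjoint, so distinct charts meet only over the two half-spaces. There the sign
    of [im2] is locally constant, and so are the transition maps. *)
Lemma in_chart_neq (i j : nat) p : i != j -> in_chart i p -> in_chart j p -> im2 p != 0.
Proof. by move=> ij [//|h1] [//|h2]; rewrite (window_inj h1 h2) eqxx in ij. Qed.

(** The affine map [m] acting on the fibre coordinate, written as the identity plus a correction so
    that differentiability is immediate. *)
Definition shear m p : V :=
  p + (creal (m.1 - 1) * p 0 o2 + creal m.2) *: delta_mx 0 o2.

Lemma shear_o2 m p : shear m p 0 o2 = creal m.1 * p 0 o2 + creal m.2.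
Proof.
rewrite /shear !mxE !eqxx mulr1.
have -> : creal (m.1 - 1) = creal m.1 - 1.
  by rewrite /creal; apply/eqP; rewrite eq_complex /= subr0 !eqxx.
ring.
Qed.

Lemma shear_neq m p (j : 'I_3) : j != o2 -> shear m p 0 j = p 0 j.
Proof. by move=> /negbTE jo; rewrite /shear !mxE jo andbF mulr0 addr0. Qed.

Lemma rV3P p q : p 0 o0 = q 0 o0 -> p 0 o1 = q 0 o1 -> p 0 o2 = q 0 o2 -> p = q.
Proof.
move=> h0 h1 h2; apply/rowP => -[[|[|[|//]]] k].
- by rewrite (_ : Ordinal k = o0) //; apply/val_inj.
- by rewrite (_ : Ordinal k = o1) //; apply/val_inj.
- by rewrite (_ : Ordinal k = o2) //; apply/val_inj.
Qed.

Lemma shear_id p : shear (1, 0) p = p.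
Proof. by rewrite /shear /= subrr mul0r add0r scale0r addr0. Qed.

Lemma shear_comp m n p : shear m (shear n p) = shear (acomp m n) p.
Proof.
by apply: rV3P; [rewrite !shear_neq | rewrite !shear_neq |
  rewrite !shear_o2 /= crealM crealD crealM; ring].
Qed.

Lemma im1_shear m p : im1 (shear m p) = im1 p.
Proof. by rewrite /im1 shear_neq. Qed.

Lemma im2_shear m p : im2 (shear m p) = im2 p.
Proof. by rewrite /im2 shear_neq. Qed.

Lemma in_half_plane_shear m p : 0 < m.1 -> in_half_plane (shear m p) <-> in_half_plane p.
Proof.
by move=> m0; rewrite /in_half_plane shear_o2 Im_affine pmulr_rgt0.
Qed.

Lemma window_shear i m p : window i (shear m p) <-> window i p.
Proof. by rewrite /window im1_shear. Qed.

Lemma in_chart_shear i m p : in_chart i (shear m p) <-> in_chart i p.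
Proof. by rewrite /in_chart im2_shear /window im1_shear. Qed.

Lemma differentiable_shear m p : differentiable (shear m) p.
Proof.
have dk : differentiable (fun q : V => creal (m.1 - 1) * q 0 o2 + creal m.2) p.
  have dw : differentiable (fun q : V => q 0 o2 : C) p by exact: differentiable_coord.
  exact: (differentiableD (differentiableM (differentiable_cst _ _) dw)
    (differentiable_cst _ _)).
have did : differentiable (id : V -> V) p by [].
exact: (differentiableD did (differentiableZl _ dk)).
Qed.

(** Decoding [i] enumerates all pairs of rationals. A multiplier that is not positive is replaced by
    1 and a number that is not a code gives the identity, so every value preserves the
    half-plane. *)
Definition monodromy (i : nat) : R * R :=
  if (unpickle i : option (rat * rat)) is Some (a, b)
  then (if 0 < a then ratr a else 1, ratr b) else (1, 0).

Lemma monodromy_gt0 i : 0 < (monodromy i).1.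
Proof.
rewrite /monodromy; case: unpickle => [[a b]|] //=.
by case: ifPn => // a0; rewrite ltr0q.
Qed.

(* A point of the bundle is given by (z1, z2, w) with w in the trivialization of
   its half-space, the window itself being attached to Im z2 > 0.  Chart i
   extends the trivialization over Im z2 > 0 through window i. *)
Definition glue i (t : R) : R * R := if t < 0 then monodromy i else (1, 0).

Lemma glue_gt0 i t : 0 < (glue i t).1.
Proof. by rewrite /glue; case: ifP => // _; exact: monodromy_gt0. Qed.

Definition chart_coord i p := shear (glue i (im2 p)) p.
Definition chart_coord_inv i p := shear (ainv (glue i (im2 p))) p.

Lemma chart_coordK i p : chart_coord_inv i (chart_coord i p) = p.
Proof.
rewrite /chart_coord_inv /chart_coord im2_shear shear_comp -[RHS]shear_id; congr (shear _ p).
exact/acompV/glue_gt0.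
Qed.

Lemma chart_coord_invK i p : chart_coord i (chart_coord_inv i p) = p.
Proof.
rewrite /chart_coord_inv /chart_coord im2_shear shear_comp -[RHS]shear_id; congr (shear _ p).
exact/acompNV/glue_gt0.
Qed.

Lemma im2_sign_near p : im2 p != 0 -> \forall q \near p, (im2 q < 0) = (im2 p < 0).
Proof.
rewrite neq_lt => /orP[h|h].
  have := @open_nbhs_nbhs _ p _ (conj (@open_Im_lt o1 0) h).
  by apply: filterS => q; rewrite /= -/(im2 q) h => ->.
have := @open_nbhs_nbhs _ p _ (conj (@open_Im_gt o1 0) h).
by apply: filterS => q; rewrite /= -/(im2 q) => h'; rewrite !ltNge !ltW.
Qed.

(** [glue] depends only on the sign of [im2], which does not change near [q] when the two charts
    differ: this is the flatness of the bundle. *)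
Lemma transition_near i j q : in_chart i q -> in_chart j q ->
  exists2 m : R * R, 0 < m.1 & \forall p \near q, chart_coord j (chart_coord_inv i p) = shear m p.
Proof.
move=> iq jq; have [->|ij] := eqVneq i j.
  exists (1, 0) => //; apply: (@filterE _ (nbhs q) (nbhs_filter q)) => p.
  by rewrite chart_coord_invK shear_id.
have nq := im2_sign_near (in_chart_neq ij iq jq).
exists (acomp (glue j (im2 q)) (ainv (glue i (im2 q)))).
  by apply: acomp_gt0; [|apply: ainv_gt0]; exact: glue_gt0.
apply: (@filterS _ (nbhs q) (nbhs_filter q) _ _ _ nq) => p hp.
by rewrite /chart_coord /chart_coord_inv im2_shear shear_comp /glue hp.
Qed.

Definition total p : bool := `[< in_half_plane p /\ exists i, in_chart i p >].

Record bundle := Bundle { raw :> V ; raw_total : total raw }.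
HB.instance Definition _ := [isSub for raw].
HB.instance Definition _ := [Choice of bundle by <:].

Definition row3 (a b w : C) : V := \row_j [tuple a; b; w]`_j.

Lemma row3_0 a b w : row3 a b w 0 o0 = a. Proof. by rewrite mxE. Qed.
Lemma row3_1 a b w : row3 a b w 0 o1 = b. Proof. by rewrite mxE. Qed.
Lemma row3_2 a b w : row3 a b w 0 o2 = w. Proof. by rewrite mxE. Qed.

Lemma base_subproof : total (row3 0 (cplx 0 1) (cplx 0 1)).
Proof.
apply/asboolP; split; first by rewrite /in_half_plane row3_2 /=.
by exists 0%N; left; rewrite /im2 row3_1 /= oner_neq0.
Qed.

Definition base_pt := Bundle base_subproof.

(** Made total by returning [base_pt] whenever the formula leaves the total space. *)
Definition of_coord i q : bundle := insubd base_pt (chart_coord_inv i q).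

Definition coord_image i q := in_chart i q /\ in_half_plane q.

Lemma open_coord_image i : open (coord_image i).
Proof. by apply: openI; [exact: open_in_chart | exact: open_in_half_plane]. Qed.

Lemma raw_in_half_plane (x : bundle) : in_half_plane x.
Proof. by have /asboolP[] := raw_total x. Qed.

Lemma raw_in_chart (x : bundle) : exists i, in_chart i x.
Proof. by have /asboolP[] := raw_total x. Qed.

Lemma raw_of_coord i q : coord_image i q -> raw (of_coord i q) = chart_coord_inv i q.
Proof.
move=> [iq hq]; rewrite -[raw]/val val_insubd; case: ifPn => // /negP[].
apply/asboolP; split; first by apply/in_half_plane_shear => //; exact/ainv_gt0/glue_gt0.
by exists i; apply/in_chart_shear.
Qed.

Lemma of_coordK i (x : bundle) : of_coord i (chart_coord i x) = x.
Proof. by apply/val_inj; rewrite /of_coord chart_coordK valKd. Qed.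

Lemma chart_coord_of_coord i q : coord_image i q -> chart_coord i (of_coord i q) = q.
Proof. by move=> h; rewrite raw_of_coord // chart_coord_invK. Qed.

Lemma coord_image_chart_coord i (x : bundle) : in_chart i x -> coord_image i (chart_coord i x).
Proof.
move=> ix; split; first exact/in_chart_shear.
by apply/in_half_plane_shear; [exact: glue_gt0 | exact: raw_in_half_plane].
Qed.

Lemma in_chart_of_coord i j q : coord_image i q -> in_chart j (of_coord i q) <-> in_chart j q.
Proof. by move=> h; rewrite raw_of_coord //; exact: in_chart_shear. Qed.

(** The topology is glued from the charts and is not induced by [raw]: along a continuous path
    crossing [im2 = 0] inside window [i], the third raw coordinate jumps by [monodromy i]. *)
Definition bundle_open (A : set bundle) :=
  forall i, open [set q | coord_image i q /\ A (of_coord i q)].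

Lemma bundle_openT : bundle_open setT.
Proof.
move=> i; rewrite (_ : [set q | _] = coord_image i); first exact: open_coord_image.
by apply/seteqP; split => q // [].
Qed.

Lemma bundle_openI : setI_closed bundle_open.
Proof.
move=> A B oA oB i.
rewrite (_ : [set q | _] = [set q | coord_image i q /\ A (of_coord i q)] `&`
  [set q | coord_image i q /\ B (of_coord i q)]).
  by apply: openI.
by apply/seteqP; split => q; [move=> [h []] | move=> [[h ?] [_ ?]]].
Qed.

Lemma bundle_open_bigU (I : Type) (f : I -> set bundle) :
  (forall k, bundle_open (f k)) -> bundle_open (\bigcup_k f k).
Proof.
move=> of_ i.
rewrite (_ : [set q | _] = \bigcup_k [set q | coord_image i q /\ f k (of_coord i q)]).
  by apply: bigcup_open => k _; exact: of_.
apply/seteqP; split => q; first by move=> [h [k _ fk]]; exists k.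
by move=> [k _ [h fk]]; split => //; exists k.
Qed.

HB.instance Definition _ := isOpenTopological.Build bundle
  bundle_openT bundle_openI bundle_open_bigU.

Lemma bundle_openE (A : set bundle) : open A = bundle_open A.
Proof. by []. Qed.

End Bundle.

(** * Differentials of maps agreeing near a point *)

Section Differential.
Variables (K : numFieldType) (U W : normedModType K).

Lemma near_eq_diff (f g : U -> W) x : (\forall y \near x, f y = g y) ->
  differentiable g x -> differentiable f x /\ 'd f x = 'd g x :> (U -> W).
Proof.
move=> fg dg; have fgx : f x = g x by exact: nbhs_singleton fg.
have E : f \o shift x = cst (f x) + 'd g x +o_ 0 id.
  apply/eqaddoP => e e0.
  have [_ /eqaddoP/(_ e e0) dgx] := (diff_locallyP _ _).1 dg.
  have fg0 : \forall y \near 0, f (y + x) = g (y + x).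
    by move: fg; rewrite (near_shift 0) subr0.
  near=> y.
  rewrite -[leLHS]/(`|f (y + x) - (f x + 'd g x y)|).
  rewrite fgx; have -> : f (y + x) = g (y + x) by near: y.
  by near: y; exact: dgx.
have D : 'd f x = 'd g x :> (U -> W).
  exact: (diff_unique (diff_continuous dg) E).
split=> //; apply/diff_locallyP; rewrite D; split => //.
exact: (diff_continuous dg).
Unshelve. all: by end_near. Qed.

End Differential.

(** * The bundle as a complex manifold *)

Section BundleManifold.
Variable R : realType.
Notation C := (Cplx R).
Notation V := ('rV[C]_3).
Notation bundle := (bundle R).
Implicit Types (p q : V).

(** Openness has to be tested in every chart [j]; near each point the passage from chart [j] to
    chart [i] is a fixed [shear], which is continuous. *)
Lemma open_chart_preimage i (B : set V) : open B ->
  open [set x : bundle | in_chart i x /\ B (chart_coord i x)].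
Proof.
move=> oB; rewrite bundle_openE => j; rewrite openE => q [[jq hq] [iq Bq]].
have jq' : coord_image j q by [].
have iq' : in_chart i q by apply/(in_chart_of_coord i jq').
have [m _ near_m] := transition_near jq iq'.
have Bm : B (shear m q).
  by move: Bq; rewrite raw_of_coord // (nbhs_singleton near_m).
have nB : \forall p \near q, B (shear m p).
  apply: (differentiable_continuous (differentiable_shear m q)).
  exact: open_nbhs_nbhs.
have nj : nbhs q (coord_image j).
  by apply: open_nbhs_nbhs; split => //; exact: open_coord_image.
have ni : nbhs q (in_chart i) by apply: open_nbhs_nbhs; split => //; exact: open_in_chart.
have nn := nbhsVI (nbhsVI near_m nB) (nbhsVI nj ni).
apply: nbhsVS nn => p [[e Bp] [cp ip]].
split; first exact: cp.
split; first exact: (in_chart_of_coord i cp).2 ip.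
by rewrite raw_of_coord // e.
Qed.

Lemma bundle_chart_img i : chart_coord i @` [set x : bundle | in_chart i x] = @coord_image R i.
Proof.
apply/seteqP; split => q; first by move=> [x ix <-]; exact: coord_image_chart_coord.
move=> cq; exists (of_coord i q); last exact: chart_coord_of_coord.
by apply/(in_chart_of_coord i cq); case: cq.
Qed.

Lemma bundle_open_chart_dom i : open [set x : bundle | in_chart i x].
Proof.
have -> : [set x : bundle | in_chart i x] =
    [set x : bundle | in_chart i x /\ [set: V] (chart_coord i x)].
  by apply/seteqP; split => x //= [].
exact/open_chart_preimage/openT.
Qed.

Lemma chart_coord_continuous i (x : bundle) : in_chart i x ->
  {for x, continuous (fun y : bundle => chart_coord i y)}.
Proof.
move=> ix B; rewrite nbhsE => -[B' [oB' B'x] B'B]; rewrite nbhs_filterE nbhsE.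
exists [set y : bundle | in_chart i y /\ B' (chart_coord i y)].
  by split; [exact: open_chart_preimage | split].
by move=> y [_ /B'B].
Qed.

Lemma of_coord_continuous i q : coord_image i q -> {for q, continuous (@of_coord R i)}.
Proof.
move=> cq B; rewrite nbhsE => -[B' [oB' B'x] B'B].
apply: (@filterS _ (nbhs q) (nbhs_filter q) [set p | coord_image i p /\ B' (of_coord i p)]).
  by move=> p [_ /B'B].
by apply: open_nbhs_nbhs; split => //; exact: oB'.
Qed.

Definition bundle_chart (i : nat) : chart R bundle 3.
Proof.
apply: (@Chart R bundle 3 [set x | in_chart i x] (fun x => chart_coord i x) (@of_coord R i)).
- exact: bundle_open_chart_dom.
- by rewrite bundle_chart_img; exact: open_coord_image.
- by move=> x _; exact: of_coordK.
- by move=> x; exact: chart_coord_continuous.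
- by move=> q; rewrite bundle_chart_img; exact: of_coord_continuous.
Defined.

(** Two points in a common chart are separated by that chart. Otherwise both lie over [im2 = 0] in
    distinct windows, which are disjoint open sets. *)
Lemma bundle_hausdorff : hausdorff_space bundle.
Proof.
rewrite open_hausdorff => x y xy.
have [i ix] := raw_in_chart x; have [j jy] := raw_in_chart y.
have [[k [kx ky]]|nk] := pselect (exists k, in_chart k x /\ in_chart k y).
  have txy : chart_coord k x != chart_coord k y.
    by apply: contra xy => /eqP h; rewrite -(of_coordK k x) h of_coordK.
  have := @norm_hausdorff C V.
  rewrite open_hausdorff => /(_ _ _ txy)[[A B] /= [xA yB] [oA oB AB]].
  exists ([set x : bundle | in_chart k x /\ A (chart_coord k x)],
          [set x : bundle | in_chart k x /\ B (chart_coord k x)]) => /=.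
    by split; apply/mem_set; split => //; apply/set_mem.
  split; [exact: open_chart_preimage | exact: open_chart_preimage |].
  apply/eqP/seteqP; split => // z [[_ Az] [_ Bz]].
  by move/eqP/seteqP: AB => [/(_ (chart_coord k z)) + _]; apply.
have wx : window i x.
  by case: ix => // h; exfalso; apply: nk; exists j; split => //; left.
have wy : window j y.
  by case: jy => // h; exfalso; apply: nk; exists i; split => //; left.
have W k : open [set z : bundle | window k z].
  have -> : [set z : bundle | window k z] =
      [set z : bundle | in_chart k z /\ window k (chart_coord k z)].
    apply/seteqP; split => z /=; last by move=> [_ /window_shear].
    by move=> wz; split; [right | apply/window_shear].
  exact/open_chart_preimage/open_window.
exists ([set z : bundle | window i z], [set z : bundle | window j z]) => /=.
  by split; apply/mem_set.
split=> //; apply/eqP/seteqP; split => // z [/= wi wj].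
apply: nk; exists i; split => //; right.
by rewrite (window_inj wi wj).
Qed.

(** Polydiscs with rational centre and radius; the finite function type makes the set of indices
    countable. *)
Definition rat_ball (k : {ffun 'I_3 -> rat * rat} * nat) : set V :=
  [set q | forall j, Mod (q 0 j - cplx (ratr (k.1 j).1) (ratr (k.1 j).2)) < k.2.+1%:R^-1].

Lemma open_rat_ball k : open (rat_ball k).
Proof.
pose S j := [set q : V | Mod (q 0 j - cplx (ratr (k.1 j).1) (ratr (k.1 j).2)) < k.2.+1%:R^-1].
have oS j : open (S j).
  rewrite /S; set c := cplx _ _; set r := _^-1.
  apply: (@open_coord _ (fun z => Mod (z - c) < r)) => z zr.
  exists (r - Mod (z - c)) => [|w wz]; first by rewrite subr_gt0.
  have -> : w - c = (w - z) + (z - c) by ring.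
  by apply: (le_lt_trans (ModD _ _)); lra.
have -> : rat_ball k = S o0 `&` (S o1 `&` S o2).
  apply/seteqP; split => q; first by move=> h; split; [|split]; exact: h.
  move=> [h0 [h1 h2]] [[|[|[|//]]] l].
  - by rewrite (_ : Ordinal l = o0) //; apply/val_inj.
  - by rewrite (_ : Ordinal l = o1) //; apply/val_inj.
  - by rewrite (_ : Ordinal l = o2) //; apply/val_inj.
by apply: openI => //; exact: openI.
Qed.

Lemma rat_ball_dense q (A : set V) : nbhs q A ->
  exists2 k, rat_ball k q & rat_ball k `<=` A.
Proof.
move=> /nbhsV[e e0 eA].
have [n hn] : exists n : nat, n.+1%:R^-1 < e / 2.
  exists (Num.truncn (e / 2)^-1).
  have e2 : 0 < e / 2 by rewrite divr_gt0.
  rewrite -[ltRHS]invrK ltf_pV2 ?posrE ?invr_gt0 //; exact: truncnS_gt.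
have approx (x : R) : exists a : rat, `|x - ratr a| < n.+1%:R^-1 / 2.
  have : 0 < n.+1%:R^-1 / 2 :> R by rewrite divr_gt0 // invr_gt0.
  move: (n.+1%:R^-1 / 2) => d d0.
  have [|a] := @rat_in_itvoo R (x - d) (x + d); first lra.
  by rewrite in_itv /= => /andP[h1 h2]; exists a; rewrite ltr_norml; apply/andP; split; lra.
have [a ha] := choice approx.
exists ([ffun j => (a (complex.Re (q 0 j)), a (complex.Im (q 0 j)))], n).
  move=> j /=; rewrite ffunE /=.
  have := ha (complex.Re (q 0 j)); have := ha (complex.Im (q 0 j)).
  case: (q 0 j) => x y /=; rewrite -[Complex x y - _]/(cplx (x - _) (y - _)) => h1 h2.
  by apply: (le_lt_trans (Mod_le _ _)); rewrite [ltRHS]splitr; exact: ltrD.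
move=> p hp; apply: eA => j; have := hp j; rewrite /= ffunE /=.
have := ha (complex.Re (q 0 j)); have := ha (complex.Im (q 0 j)).
set c := cplx _ _ => h1 h2 h3.
have -> : p 0 j - q 0 j = (p 0 j - c) - (q 0 j - c) by ring.
apply: (le_lt_trans (ModD _ _)); rewrite ModN.
have : Mod (q 0 j - c) < n.+1%:R^-1.
  move: h1 h2; rewrite /c; case: (q 0 j) => x y /= h1 h2.
  rewrite -[Complex x y - _]/(cplx (x - _) (y - _)).
  by apply: (le_lt_trans (Mod_le _ _)); rewrite [ltRHS]splitr; exact: ltrD.
by move=> h4; rewrite (splitr e); apply: ltrD; [exact: lt_trans h3 hn | exact: lt_trans h4 hn].
Qed.

Lemma bundle_second_countable : @second_countable bundle.
Proof.
pose b (k : nat * ({ffun 'I_3 -> rat * rat} * nat)) : set bundle :=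
  [set x | in_chart k.1 x /\ rat_ball k.2 (chart_coord k.1 x)].
exists (range b).
  exact/(card_le_trans (card_image_le _ _))/countableP.
split=> [_ [k _ <-]|x A Ax]; first exact/open_chart_preimage/open_rat_ball.
have [i ix] := raw_in_chart x.
have cx := coord_image_chart_coord ix.
have : nbhs (chart_coord i x) (of_coord i @^-1` A).
  by apply: (of_coord_continuous cx); rewrite of_coordK.
move=> /rat_ball_dense[k kx kA].
exists (b (i, k)); first by split; [exists (i, k) | split].
by move=> y [/= iy /kA]; rewrite /= of_coordK.
Qed.

Lemma bundle_compatible i j (q : V) :
  (chart_coord i @` ([set x : bundle | in_chart i x] `&` [set x : bundle | in_chart j x])) q ->
  differentiable (fun p => chart_coord j (of_coord i p)) q.
Proof.
move=> [x [ix jx] <-]; have cx := coord_image_chart_coord ix.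
have jx' : in_chart j (chart_coord i x) by apply/in_chart_shear.
have [m _ hm] := transition_near cx.1 jx'.
apply: (proj1 (near_eq_diff _ (differentiable_shear m _))).
have nc : nbhs (chart_coord i x) (@coord_image R i).
  by apply: open_nbhs_nbhs; split => //; exact: open_coord_image.
apply: nbhsVS (nbhsVI hm nc) => p [e cp].
by rewrite raw_of_coord.
Qed.

Definition bundle_manifold : complexManifold R.
Proof.
apply: (@ComplexManifold R bundle 3 (range bundle_chart)).
- exact: bundle_hausdorff.
- exact: bundle_second_countable.
- by move=> x; have [i ix] := raw_in_chart x; exists (bundle_chart i) => //; exists i.
- by move=> _ _ [i _ <-] [j _ <-] q /= h; exact: (@bundle_compatible i j q h).
Defined.

End BundleManifold.

(** * Vanishing of the Kobayashi pseudodistance *)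

Section KobayashiDistance.
Variable R : realType.
Notation C := (Cplx R).
Notation V := ('rV[C]_3).
Notation Y := (bundle_manifold R).
Implicit Types (p v : V) (x y : bundle R) (e : R) (w : C).

Lemma unit_discE (z : C) : unit_disc z <-> Mod z < 1.
Proof. by rewrite /unit_disc /= -[1]/(creal 1) normlt. Qed.

Lemma open_unit_disc : open (@unit_disc R).
Proof.
rewrite openE => z /unit_discE z1; apply/nbhsC.
exists (1 - Mod z) => [|w wz]; first by rewrite subr_gt0.
apply/unit_discE; have -> : w = (w - z) + z by ring.
by apply: (le_lt_trans (ModD _ _)); lra.
Qed.

Lemma poincare_dist_ge0 (a b : C) : 0 <= poincare_dist a b.
Proof.
rewrite /poincare_dist; set r := real_modulus _.
have r0 : 0 <= r by exact: Mod_ge0.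
apply: divr_ge0 => //; have [r1|r1] := ltP r 1.
  by apply: ln_ge0; rewrite ler_pdivlMr ?subr_gt0 //; lra.
(* For [r >= 1] the argument of [ln] is at most 0 (it is 0 when [r = 1]), and [ln] takes the value 0
   there. *)
by rewrite ln0 //; apply: mulr_ge0_le0; rewrite ?addr_ge0 // invr_le0 subr_le0.
Qed.

(** Write the quotient as [1 + x] and use [ln (1 + x) <= x]; the denominator [1 - Mod b] is at least
    [1 / 2]. *)
Lemma poincare_dist0_le (b : C) : Mod b <= 2^-1 -> poincare_dist 0 b <= 2 * Mod b.
Proof.
move=> b1; rewrite /poincare_dist mulr0 subr0 divr1 sub0r.
rewrite -/(Mod (- b)) ModN; have b0 := Mod_ge0 b.
have -> : (1 + Mod b) / (1 - Mod b) = 1 + 2 * Mod b / (1 - Mod b).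
  by field; apply/negP => /eqP; lra.
have h : 0 <= 2 * Mod b / (1 - Mod b) by rewrite divr_ge0 // ?mulr_ge0 //; lra.
rewrite ler_pdivrMr //; apply: (le_trans (le_ln1Dx _)); first by lra.
rewrite ler_pdivrMr; last by lra.
nra.
Qed.

(** One chart at each point suffices: the differentiable transition maps carry holomorphy to all the
    others. *)
Lemma chart_holomorphic (f : C -> Y) :
  (forall z, unit_disc z -> exists i, (\forall z' \near z, in_chart i (f z' : bundle R)) /\
     derivable (fun z' => chart_coord i (f z' : bundle R)) z 1) ->
  holomorphic_disc f.
Proof.
move=> hf z /hf[i [ni di]].
have iz : in_chart i (f z : bundle R) by exact: nbhs_singleton ni.
have cz := coord_image_chart_coord iz.
have dg : differentiable (fun z' => chart_coord i (f z' : bundle R)) z by exact/derivable1_diffP.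
split.
  have -> : f = @of_coord R i \o (fun z' => chart_coord i (f z' : bundle R)).
    by apply/funext => z'; rewrite /= of_coordK.
  apply: continuous_comp; first exact: differentiable_continuous.
  exact: of_coord_continuous.
move=> _ [j _ <-] /= jz; apply/derivable1_diffP.
have -> : (fun x : bundle R => chart_coord j x) \o f =
    (fun p => chart_coord j (of_coord i p)) \o (fun z' => chart_coord i (f z' : bundle R)).
  by apply/funext => z'; rewrite /= of_coordK.
have dt : differentiable (fun p => chart_coord j (of_coord i p)) (chart_coord i (f z : bundle R)).
  by apply: bundle_compatible; exists (f z).
exact: (differentiable_comp dg dt).
Qed.

Definition affine_disc i p v (z : C) : Y := of_coord i (p + z *: v).

Lemma affine_disc_holomorphic i p v :
  (forall z, unit_disc z -> coord_image i (p + z *: v)) ->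
  holomorphic_disc (affine_disc i p v).
Proof.
move=> h; apply: chart_holomorphic => z uz; exists i.
have nz : \forall z' \near z, unit_disc z'.
  by apply: open_nbhs_nbhs; split => //; exact: open_unit_disc.
split.
  apply: (@filterS _ (nbhs z) (nbhs_filter z) _ _ _ nz) => z' /h c'.
  by apply/(in_chart_of_coord i c'); case: c'.
have E : \forall z' \near z, p + z' *: v = chart_coord i (affine_disc i p v z' : bundle R).
  apply: (@filterS _ (nbhs z) (nbhs_filter z) _ _ _ nz) => z' /h c'.
  by rewrite chart_coord_of_coord.
apply: (near_eq_derivable E) => //.
by apply/derivable1_diffP; apply: differentiableD.
Qed.

(** Chains of discs with their total length, as an inductive relation: concatenation becomes an
    induction, and sequences indexed by [nat] appear only in [kobayashi_dist_le]. *)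
Inductive reach : Y -> Y -> R -> Prop :=
| reach_disc f a b : holomorphic_disc f -> unit_disc a -> unit_disc b ->
    reach (f a) (f b) (poincare_dist a b)
| reach_cons f a b y e : holomorphic_disc f -> unit_disc a -> unit_disc b ->
    reach (f b) y e -> reach (f a) y (poincare_dist a b + e).

Lemma reach_trans (x y z : Y) e e' : reach x y e -> reach y z e' -> reach x z (e + e').
Proof.
elim=> [f a b hf ha hb|f a b y' e0 hf ha hb _ IH] h; first exact: reach_cons.
by rewrite -addrA; apply: reach_cons => //; exact: IH.
Qed.

Lemma kobayashi_dist_le (x y : Y) e : reach x y e -> (kobayashi_dist x y <= e%:E)%E.
Proof.
move=> h; apply: ereal_inf_lbound.
elim: h => [f a b hf ha hb|f a b {}y {}e hf ha hb _ [k [p [a' [b' [f' [k0 p0 pk hp []]]]]]] ->].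
  exists 1%N, (fun i => if i is 0 then f a else f b), (fun=> a), (fun=> b), (fun=> f).
  by split=> // [[|//] _|]; rewrite ?big_ord1.
exists k.+1, (fun i => if i is j.+1 then p j else f a),
  (fun i => if i is j.+1 then a' j else a), (fun i => if i is j.+1 then b' j else b),
  (fun i => if i is j.+1 then f' j else f).
split=> // [[|i]|]; [by rewrite p0|by rewrite ltnS; exact: hp|].
by rewrite big_ord_recl.
Qed.

Lemma kobayashi_dist_ge0 (x y : Y) : (0 <= kobayashi_dist x y)%E.
Proof.
apply: le_ereal_inf_tmp => _ [k [p [a [b [f [_ _ _ _ ->]]]]]].
by rewrite lee_fin; apply: sumr_ge0 => i _; exact: poincare_dist_ge0.
Qed.

Definition close (x y : Y) e := exists2 e', e' <= e & reach x y e'.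
(** Both directions are built in, so that a path found from [x] to [y] can also be followed
    backwards. *)
Definition zero_dist (x y : Y) := forall e, 0 < e -> close x y e /\ close y x e.

Lemma close_trans (x y z : Y) e e' : close x y e -> close y z e' -> close x z (e + e').
Proof.
by move=> [d1 h1 r1] [d2 h2 r2]; exists (d1 + d2); [exact: lerD | exact: reach_trans r1 r2].
Qed.

Lemma zero_dist_trans (x y z : Y) : zero_dist x y -> zero_dist y z -> zero_dist x z.
Proof.
move=> h1 h2 e e0; have e2 : 0 < e / 2 by rewrite divr_gt0.
have [a b] := h1 _ e2; have [c d] := h2 _ e2.
by split; rewrite (splitr e); [exact: close_trans a c | exact: close_trans d b].
Qed.

(* A complex line contains discs of arbitrarily large radius. *)
Lemma zero_dist_line i p v : (forall z, coord_image i (p + z *: v)) ->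
  forall z, zero_dist (of_coord i p) (of_coord i (p + z *: v)).
Proof.
have K q : (forall z, coord_image i (q + z *: v)) ->
    forall z e, 0 < e -> close (of_coord i q) (of_coord i (q + z *: v)) e.
  move=> h z e e0; have z0 := Mod_ge0 z.
  (* The line is reparametrized by the factor [T], which puts the endpoint at [b = z / T]. This [T]
     is large enough for both [Mod b <= 1 / 2] and [2 * Mod b <= e]. *)
  pose T := 2 * (Mod z + 1) * (1 + e^-1).
  have ei : 0 < e^-1 by rewrite invr_gt0.
  have T0 : 0 < T by apply: mulr_gt0; [apply: mulr_gt0 => //; lra | lra].
  pose b := creal T^-1 * z.
  have Mb : Mod b = Mod z / T.
    by rewrite /b ModM Mod_creal ger0_norm ?invr_ge0 ?ltW // mulrC.
  have b2 : Mod b <= 2^-1.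
    rewrite Mb ler_pdivrMr // /T; nra.
  have be : 2 * Mod b <= e.
    rewrite Mb mulrA ler_pdivrMr // /T.
    have -> : e * (2 * (Mod z + 1) * (1 + e^-1)) = 2 * (Mod z + 1) * (e + 1).
      by field; rewrite gt_eqF.
    nra.
  have u0 : unit_disc (0 : C) by apply/unit_discE; rewrite Mod0.
  have ub : unit_disc b by apply/unit_discE; lra.
  exists (poincare_dist 0 b); first by apply: le_trans be; exact: poincare_dist0_le.
  have := @reach_disc (affine_disc i q (creal T *: v)) 0 b.
  rewrite /affine_disc scale0r addr0 scalerA /b mulrAC -crealM mulVf ?gt_eqF //.
  rewrite [creal 1]/(1 : C) mul1r; apply => //.
  by apply: affine_disc_holomorphic => z' _; rewrite scalerA; exact: h.
move=> h z e e0; split; first exact: K.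
have := K (p + z *: v) _ (- z) e e0.
rewrite -addrA -scalerDl subrr scale0r addr0; apply => z'.
by rewrite -addrA -scalerDl; exact: h.
Qed.

Lemma line_same (j : 'I_3) p (z : C) : (p + z *: delta_mx 0 j) 0 j = p 0 j + z.
Proof. by rewrite !mxE !eqxx mulr1. Qed.

Lemma line_neq (j k : 'I_3) p (z : C) : k != j ->
  (p + z *: delta_mx 0 j) 0 k = p 0 k.
Proof. by move=> /negbTE kj; rewrite !mxE kj andbF mulr0 addr0. Qed.

Lemma chart_coord_neq i x (j : 'I_3) : j != o2 -> chart_coord i x 0 j = raw x 0 j.
Proof. exact: shear_neq. Qed.

(** Off [im2 = 0] the whole [z1] line with [z2] and [w] fixed stays in chart 0. *)
Lemma zero_dist_z1 x y : im2 x != 0 -> raw y 0 o1 = raw x 0 o1 -> raw y 0 o2 = raw x 0 o2 ->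
  zero_dist x y.
Proof.
move=> x2 h1 h2; rewrite -(of_coordK 0 x) -(of_coordK 0 y).
have -> : chart_coord 0 y = chart_coord 0 x + (raw y 0 o0 - raw x 0 o0) *: delta_mx 0 o0.
  have E2 : im2 y = im2 x by rewrite /im2 h1.
  apply: rV3P; [rewrite [RHS]line_same|rewrite [RHS]line_neq //|
    rewrite [RHS]line_neq //].
  - by rewrite !chart_coord_neq //; ring.
  - by rewrite !chart_coord_neq.
  - by rewrite /chart_coord E2 !shear_o2 h2.
apply: zero_dist_line => z; have [_ hx] := coord_image_chart_coord (or_introl x2 : in_chart 0 x).
split; last by rewrite /in_half_plane line_neq //; exact: hx.
by left; rewrite /im2 line_neq // chart_coord_neq.
Qed.

(** Over window [i] the whole [z2] line lies in chart [i]. It is the coordinate of chart [i] that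
    stays fixed, so a raw fibre coordinate changes by [monodromy i] when the line passes between the
    two half-spaces. *)
Lemma zero_dist_z2 i x y : window i x -> raw y 0 o0 = raw x 0 o0 ->
  chart_coord i y 0 o2 = chart_coord i x 0 o2 -> zero_dist x y.
Proof.
move=> xi h1 h2; rewrite -(of_coordK i x) -(of_coordK i y).
have -> : chart_coord i y = chart_coord i x + (raw y 0 o1 - raw x 0 o1) *: delta_mx 0 o1.
  apply: rV3P; [rewrite [RHS]line_neq //|rewrite [RHS]line_same|
    rewrite [RHS]line_neq //].
  - by rewrite !chart_coord_neq.
  - by rewrite !chart_coord_neq //; ring.
apply: zero_dist_line => z; have [_ hx] := coord_image_chart_coord (or_intror xi : in_chart i x).
split; last by rewrite /in_half_plane line_neq //; exact: hx.
by right; rewrite /window /im1 line_neq // chart_coord_neq.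
Qed.

(** The disc of centre [w] and radius [Im w] in the fibre stays in the half-plane, and [y] sits on
    it at a parameter of modulus at most [d]. *)
Lemma close_fiber x y (d : R) : 0 < im2 x -> raw y 0 o0 = raw x 0 o0 ->
  raw y 0 o1 = raw x 0 o1 -> d <= 2^-1 ->
  Mod (raw y 0 o2 - raw x 0 o2) <= d * complex.Im (raw x 0 o2) -> close x y (2 * d).
Proof.
move=> x2 h0 h1 d2 hd; set w := raw x 0 o2 in hd *; set t := complex.Im w in hd *.
have t0 : 0 < t by exact: raw_in_half_plane x.
have tx : chart_coord 0 x = raw x by rewrite /chart_coord /glue ltNge ltW //= shear_id.
have ty : chart_coord 0 y = raw y.
  by rewrite /chart_coord /glue (_ : im2 y = im2 x) /im2 ?h1 // ltNge ltW //= shear_id.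
pose b := creal t^-1 * (raw y 0 o2 - w).
have Mb : Mod b <= d.
  rewrite ModM Mod_creal ger0_norm ?invr_ge0 ?(ltW t0) // mulrC ler_pdivrMr //.
have u0 : unit_disc (0 : C) by apply/unit_discE; rewrite Mod0.
have ub : unit_disc b by apply/unit_discE; lra.
exists (poincare_dist 0 b).
  by apply: (le_trans (poincare_dist0_le (le_trans Mb d2))); rewrite ler_pM2l.
have := @reach_disc (affine_disc 0 (raw x) (creal t *: delta_mx 0 o2)) 0 b.
rewrite /affine_disc scale0r addr0 scalerA /b mulrAC -crealM mulVf ?gt_eqF //.
rewrite [creal 1]/(1 : C) mul1r.
have -> : raw x + (raw y 0 o2 - w) *: delta_mx 0 o2 = raw y.
  apply: rV3P; [by rewrite line_neq|by rewrite line_neq|].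
  by rewrite line_same /w; ring.
have ox : of_coord 0 (raw x) = x by rewrite -tx of_coordK.
have oy : of_coord 0 (raw y) = y by rewrite -ty of_coordK.
rewrite ox oy; apply => //.
apply: affine_disc_holomorphic => z /unit_discE z1; rewrite scalerA; split.
  by left; rewrite /im2 line_neq // gt_eqF.
rewrite /in_half_plane line_same -/w.
have := ler_norm (- complex.Im z); rewrite normrN => /le_trans/(_ (Mod_Im z)) hz.
rewrite mulrC creal_mulE; case: (w) @t t0 {hd b Mb ub} => p q /= t0; nra.
Qed.

Definition bundle_point (a b w : C) : bundle R := insubd (base_pt R) (row3 a b w).

Lemma raw_bundle_point (a b w : C) : complex.Im b != 0 -> 0 < complex.Im w ->
  raw (bundle_point a b w) = row3 a b w.
Proof.
move=> b0 w0; apply: (@insubdK _ _ (bundle R)).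
apply/asboolP; split; first by rewrite /in_half_plane row3_2.
by exists 0%N; left; rewrite /im2 row3_1.
Qed.

(** The fibre over [(i / 2, i)], which lies in the middle of window 0 with [Im z2 > 0]. *)
Definition upper w : bundle R := bundle_point (cplx 0 2^-1) (cplx 0 1) w.

Lemma raw_upper w : 0 < complex.Im w ->
  raw (upper w) = row3 (cplx 0 2^-1) (cplx 0 1) w.
Proof. by apply: raw_bundle_point; rewrite /= oner_neq0. Qed.

(** A point over [im2 = 0] is first moved along [z2] in its window, then along [z1]. Any other point
    is moved along [z1] into window 0 and then along [z2]. *)
Lemma zero_dist_upper x : exists2 w, 0 < complex.Im w & zero_dist x (upper w).
Proof.
have i1 : complex.Im (cplx 0 1 : C) != 0 by rewrite /= oner_neq0.
have [x2|x2] := eqVneq (im2 x) 0.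
  have [i [|xi]] := raw_in_chart x; first by rewrite x2 eqxx.
  have hx := raw_in_half_plane x; exists (raw x 0 o2) => //.
  apply: (@zero_dist_trans _ (bundle_point (raw x 0 o0) (cplx 0 1) (raw x 0 o2))).
    apply: (zero_dist_z2 xi); rewrite ?raw_bundle_point ?row3_0 //.
    rewrite /chart_coord !shear_o2 ?raw_bundle_point // /glue x2 ltxx /im2.
    by rewrite row3_1 row3_2 /= ltNge ler01.
  by apply: zero_dist_z1; rewrite /im2 ?raw_bundle_point // ?raw_upper // ?row3_1 ?row3_2.
pose y := bundle_point (cplx 0 2^-1) (raw x 0 o1) (raw x 0 o2).
have hx := raw_in_half_plane x.
have ry : raw y = row3 (cplx 0 2^-1) (raw x 0 o1) (raw x 0 o2) by exact: raw_bundle_point.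
have y0 : window 0 y.
  by rewrite /window /im1 ry row3_0 /= ; apply/andP; split; [rewrite invr_gt0|lra].
have hw : 0 < complex.Im (chart_coord 0 y 0 o2).
  by have [] := coord_image_chart_coord (or_intror y0 : in_chart 0 y).
exists (chart_coord 0 y 0 o2) => //; apply: (@zero_dist_trans _ y).
  by apply: zero_dist_z1; rewrite ?ry ?row3_1 ?row3_2.
apply: (zero_dist_z2 y0); first by rewrite raw_upper // ry !row3_0.
rewrite {1}/chart_coord shear_o2 raw_upper // row3_2 /im2 row3_1 /glue /= ltNge ler01 /=.
by rewrite -[creal 1]/(1 : C) -[creal 0]/(0 : C) mul1r addr0.
Qed.

Definition window_mid (j : nat) : C := cplx 0 (j%:R + 2^-1).

Lemma window_bundle_point (j : nat) (b w : C) : complex.Im b != 0 -> 0 < complex.Im w ->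
  window j (bundle_point (window_mid j) b w).
Proof.
move=> b0 w0; rewrite /window /im1 raw_bundle_point // row3_0 [complex.Im _]/(j%:R + 2^-1).
by rewrite -(natr1 j) ltrDl ltrD2l invr_gt0 ltr0n invf_lt1 ?ltr1n ?ltr0n.
Qed.

Lemma monodromy_Im_gt0 i w : 0 < complex.Im w ->
  0 < complex.Im (creal (monodromy R i).1 * w + creal (monodromy R i).2).
Proof.
by rewrite Im_affine => w0; rewrite mulr_gt0 // monodromy_gt0.
Qed.

(* Going down through a window glued by the identity and up through window i. *)
Lemma zero_dist_loop i w : 0 < complex.Im w ->
  zero_dist (upper w) (upper (creal (monodromy R i).1 * w + creal (monodromy R i).2)).
Proof.
move=> w0; set w' := _ + _.
have w0' : 0 < complex.Im w' by exact: monodromy_Im_gt0.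
have i1 : complex.Im (cplx 0 1 : C) != 0 by rewrite /= oner_neq0.
have iN1 : complex.Im (cplx 0 (- 1) : C) != 0 by rewrite /= oppr_eq0 oner_neq0.
have [k monok] : exists k, monodromy R k = (1, 0).
  by exists (pickle ((1, 0) : rat * rat)); rewrite /monodromy pickleK /= rmorph1 rmorph0.
apply: (@zero_dist_trans _ (bundle_point (window_mid k) (cplx 0 1) w)).
  by apply: zero_dist_z1; rewrite /im2 ?raw_upper // ?raw_bundle_point // ?row3_1 ?row3_2.
apply: (@zero_dist_trans _ (bundle_point (window_mid k) (cplx 0 (- 1)) w)).
  apply: (@zero_dist_z2 k); first by apply: window_bundle_point.
    by rewrite !raw_bundle_point // !row3_0.
  rewrite /chart_coord !shear_o2 !raw_bundle_point // /glue /im2 !row3_1 !row3_2 /= monok.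
  by rewrite !if_same.
apply: (@zero_dist_trans _ (bundle_point (window_mid i) (cplx 0 (- 1)) w)).
  by apply: zero_dist_z1; rewrite /im2 !raw_bundle_point ?row3_1 ?row3_2.
apply: (@zero_dist_trans _ (bundle_point (window_mid i) (cplx 0 1) w')).
  apply: (@zero_dist_z2 i); first by apply: window_bundle_point.
    by rewrite !raw_bundle_point // !row3_0.
  rewrite /chart_coord !shear_o2 !raw_bundle_point // /glue /im2 !row3_1 !row3_2 /=.
  rewrite ltNge ler01 /= ltrN10.
  by rewrite -[creal 1]/(1 : C) -[creal 0]/(0 : C) mul1r addr0.
by apply: zero_dist_z1; rewrite /im2 ?raw_upper // ?raw_bundle_point // ?row3_1 ?row3_2.
Qed.

(** A rational multiplier adjusts the imaginary part of [w2] to that of [w1], then a rational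
    translation adjusts the real part, each within [d / 2]. *)
Lemma monodromy_dense (w1 w2 : C) (d : R) : 0 < complex.Im w1 -> 0 < complex.Im w2 -> 0 < d ->
  exists i, Mod (creal (monodromy R i).1 * w2 + creal (monodromy R i).2 - w1) <= d.
Proof.
case: w1 w2 => x1 t1 [x2 t2] /= h1 h2 d0.
have [|a] := @rat_in_itvoo R (t1 / t2) ((t1 + d / 2) / t2).
  by rewrite ltr_pM2r ?invr_gt0 //; lra.
rewrite in_itv /= ltr_pdivrMr // ltr_pdivlMr // => /andP[a1 a2].
have [|b] := @rat_in_itvoo R (x1 - ratr a * x2) (x1 - ratr a * x2 + d / 2); first lra.
rewrite in_itv /= => /andP[b1 b2].
have a0 : 0 < a by rewrite -(ltr0q R) -(pmulr_lgt0 _ h2) (lt_trans h1).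
exists (pickle (a, b)); rewrite /monodromy pickleK a0 /=.
rewrite creal_mulE /=.
rewrite -[_ - _]/(cplx (ratr a * x2 + ratr b - x1) (ratr a * t2 + 0 - t1)).
apply: (le_trans (Mod_le _ _)); rewrite !ger0_norm; lra.
Qed.

Lemma kobayashi_dist_bundle (p q : Y) : kobayashi_dist p q = 0%E.
Proof.
apply/eqP; rewrite eq_le kobayashi_dist_ge0 andbT.
apply/lee_addgt0Pr => e e0; rewrite add0e.
have [w1 t1 p1] := zero_dist_upper p; have [w2 t2 q2] := zero_dist_upper q.
(* The bound [2^-1] serves [close_fiber]; with [e / 8] the total length is at most
   [e / 4 + 2 * d + e / 4 <= e]. *)
pose d := Num.min (2^-1) (e / 8).
have d0 : 0 < d by rewrite lt_min invr_gt0 divr_gt0 //= ltr0n.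
have dt : 0 < d * complex.Im w1 by rewrite mulr_gt0.
have [i hi] := monodromy_dense t1 t2 dt.
have i1 : complex.Im (cplx 0 1 : C) != 0 by rewrite /= oner_neq0.
set w' := creal _ * _ + creal _ in hi.
have w0' : 0 < complex.Im w' by exact: monodromy_Im_gt0.
have c2 : close (upper w1) (upper w') (2 * d).
  apply: close_fiber; rewrite /im2 ?raw_upper // ?row3_0 ?row3_1 ?row3_2 //=.
  by rewrite /d ge_min lexx.
have e4 : 0 < e / 4 by rewrite divr_gt0.
have [c1 _] := p1 _ e4.
have [_ c3] := zero_dist_trans q2 (zero_dist_loop i t2) e4.
have [e' he r] := close_trans c1 (close_trans c2 c3).
apply: (le_trans (kobayashi_dist_le r)); rewrite lee_fin; apply: (le_trans he).
have : d <= e / 8 by rewrite /d ge_min lexx orbT.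
lra.
Qed.

End KobayashiDistance.

(** * Lifting discs and the Kobayashi-Royden pseudometric *)

(** The level set of [q] through [x0] is both relatively open and relatively closed in [E]. *)
Lemma connected_locally_constant (T : topologicalType) (U : Type) (E : set T)
    (q : T -> U) x0 :
  connected E -> E x0 -> (forall x, E x -> \forall y \near x, E y -> q y = q x) ->
  forall x, E x -> q x = q x0.
Proof.
move=> cE Ex0 qE x Ex.
pose B := [set y | E y /\ q y = q x0].
suff BE : B = E by move: Ex; rewrite -BE => -[].
apply: cE; first by exists x0.
- exists (interior [set y | E y -> q y = q x0]); first exact: open_interior.
  apply/seteqP; split => y [Ey qy]; split => //; last exact: nbhs_singleton qy Ey.
  by apply: filterS (qE y Ey) => z qz Ez; rewrite qz.
- exists (~` interior [set y | E y -> q y <> q x0]).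
    exact/open_closedC/open_interior.
  apply/seteqP; split => y [Ey qy]; split => //.
    by move=> /nbhs_singleton/(_ Ey).
  apply: contrapT => nq; apply: qy.
  by apply: filterS (qE y Ey) => z qz Ez; rewrite qz.
Qed.

(** * Closed rectangles, possibly degenerate to segments *)

Section Rectangles.
Variable R : realType.
Notation C := (Cplx R).

Definition rect (x x' y y' : R) : set C :=
  [set z | x <= complex.Re z <= x' /\ y <= complex.Im z <= y'].

Lemma rect_out x x' y y' z : ~ rect x x' y y' z -> \forall w \near z, ~ rect x x' y y' w.
Proof.
have key (f : C -> R) a : (forall u v, `|f v - f u| <= Mod (v - u)) ->
    (f z < a -> \forall w \near z, ~~ (a <= f w)) /\
    (a < f z -> \forall w \near z, ~~ (f w <= a)).
  move=> hf; split=> h; apply/nbhsC.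
    exists (a - f z) => [|w]; first by rewrite subr_gt0.
    move=> /(le_lt_trans (hf _ _)); rewrite ltr_norml -ltNge => /andP[]; lra.
  exists (f z - a) => [|w]; first by rewrite subr_gt0.
  move=> /(le_lt_trans (hf _ _)); rewrite ltr_norml -ltNge => /andP[]; lra.
move=> nz; have : [\/ complex.Re z < x, x' < complex.Re z,
    complex.Im z < y | y' < complex.Im z].
  have [h1|h1] := ltP (complex.Re z) x; first by constructor 1.
  have [h2|h2] := ltP x' (complex.Re z); first by constructor 2.
  have [h3|h3] := ltP (complex.Im z) y; first by constructor 3.
  have [h4|h4] := ltP y' (complex.Im z); first by constructor 4.
  by exfalso; apply: nz; rewrite /rect /= h1 h2 h3 h4.
case=> [/(key _ x (@Mod_ReB R)).1|/(key _ x' (@Mod_ReB R)).2|/(key _ y (@Mod_ImB R)).1|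
  /(key _ y' (@Mod_ImB R)).2]; apply: filterS => w /negP nw [/andP[a b] /andP[c d]];
  exact: nw.
Qed.

Lemma rect_vert_connected x y y' : connected (rect x x y y').
Proof.
have -> : rect x x y y' = (fun t => cplx x t) @` `[y, y'].
  apply/seteqP; split=> [[a b] [/= h1 h2]|_ [t /= ht <-]].
    by exists b; [rewrite /= in_itv | rewrite /cplx; congr Complex; apply/eqP; rewrite eq_le].
  by split; rewrite /= ?lexx //; move: ht; rewrite in_itv.
apply: connected_continuous_connected; first exact: segment_connected.
apply: continuous_subspaceT => t A /nbhsC[e e0 eA].
rewrite nbhs_filterE; apply/nbhs_ballP; exists e => // s ts; apply: eA.
rewrite -[_ - _]/(cplx (x - x) (s - t)) subrr.
by apply: (le_lt_trans (Mod_le _ _)); rewrite normr0 add0r distrC.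
Qed.

Lemma rect_horiz_connected x x' y : connected (rect x x' y y).
Proof.
have -> : rect x x' y y = (fun t => cplx t y) @` `[x, x'].
  apply/seteqP; split=> [[a b] [/= h1 h2]|_ [t /= ht <-]].
    by exists a; [rewrite /= in_itv | rewrite /cplx; congr Complex; apply/eqP; rewrite eq_le].
  by split; rewrite /= ?lexx //; move: ht; rewrite in_itv.
apply: connected_continuous_connected; first exact: segment_connected.
apply: continuous_subspaceT => t A /nbhsC[e e0 eA].
rewrite nbhs_filterE; apply/nbhs_ballP; exists e => // s ts; apply: eA.
rewrite -[_ - _]/(cplx (s - t) (y - y)) subrr.
by apply: (le_lt_trans (Mod_le _ _)); rewrite normr0 addr0 distrC.
Qed.

End Rectangles.

Lemma bundle_im2_sign_near (R : realType) (x : bundle R) : im2 x != 0 ->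
  \forall y \near x, (im2 (y : bundle R) < 0) = (im2 x < 0).
Proof.
move=> x2; have iz : in_chart 0 x by left.
have nx : \forall q \near chart_coord 0 x, (im2 q < 0) = (im2 (chart_coord 0 x) < 0).
  by apply: im2_sign_near; rewrite im2_shear.
have nn : nbhs x [set y : bundle R | (im2 (chart_coord 0 y) < 0) = (im2 (chart_coord 0 x) < 0)].
  exact: chart_coord_continuous iz _ nx.
by apply: (@filterS _ (nbhs x) (nbhs_filter x) _ _ _ nn) => y; rewrite /= !im2_shear.
Qed.

(** * Continuation of the fibre coordinate along a map into the bundle *)

Section Lifting.
Variable R : realType.
Notation C := (Cplx R).
Variable f : C -> bundle R.
Implicit Types (S : set C) (c : C -> R * R).

(* Applying c z to the third coordinate of f z gives a function that is locally
   an affine image of the fibre coordinate of f in any chart. *)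
Definition flat_lift S c := forall z i, S z -> in_chart i (f z) ->
  exists2 m : R * R, 0 < m.1 &
    \forall w \near z, S w -> c w = acomp m (glue i (im2 (f w))).

Lemma flat_lift_gt0 S c z : flat_lift S c -> S z -> 0 < (c z).1.
Proof.
move=> L Sz; have [i iz] := raw_in_chart (f z).
have [m m0 /nbhs_singleton/(_ Sz) ->] := L z i Sz iz.
by apply: acomp_gt0 => //; exact: glue_gt0.
Qed.

(** On the overlap the quotient of [c1] by [c2] is locally constant, hence constant by
    connectedness; composing [c2] with this constant makes the two lifts agree. Closedness of the
    sets handles the points that belong to only one of them. *)
Lemma flat_lift_glue S1 S2 c1 c2 z0 :
  (forall z, ~ S1 z -> \forall w \near z, ~ S1 w) ->
  (forall z, ~ S2 z -> \forall w \near z, ~ S2 w) ->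
  connected (S1 `&` S2) -> S1 z0 -> S2 z0 -> flat_lift S1 c1 -> flat_lift S2 c2 ->
  exists c, flat_lift (S1 `|` S2) c.
Proof.
move=> cl1 cl2 cE z01 z02 L1 L2.
pose q z := acomp (c1 z) (ainv (c2 z)).
have qE z : (S1 `&` S2) z -> q z = q z0.
  apply: (connected_locally_constant cE) => // {z}z [z1 z2].
  have [i iz] := raw_in_chart (f z).
  have [m1 m10 n1] := L1 z i z1 iz; have [m2 m20 n2] := L2 z i z2 iz.
  have E w : S1 w -> S2 w -> c1 w = acomp m1 (glue i (im2 (f w))) ->
      c2 w = acomp m2 (glue i (im2 (f w))) -> q w = acomp m1 (ainv m2).
    move=> w1 w2 e1 e2.
    have e : c1 w = acomp (acomp m1 (ainv m2)) (c2 w) by rewrite e1 e2 acompA acompVK.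
    by rewrite /q e acompK //; exact: flat_lift_gt0 L2 w2.
  apply: filterS2 (n1) (n2) => w e1 e2 [w1 w2].
  by rewrite !E ?e1 ?e2 //; [exact: (nbhs_singleton n1)|exact: (nbhs_singleton n2)].
have q0 : 0 < (q z0).1.
  apply: acomp_gt0; first exact: flat_lift_gt0 L1 z01.
  by apply: ainv_gt0; exact: flat_lift_gt0 L2 z02.
pose c z := if `[< S1 z >] then c1 z else acomp (q z0) (c2 z).
have c1E z : S1 z -> c z = c1 z by move=> h; rewrite /c asboolT.
have c2E z : S2 z -> c z = acomp (q z0) (c2 z).
  move=> h; rewrite /c; case: asboolP => // h1.
  by rewrite -(qE z) // /q acompVK //; exact: flat_lift_gt0 L2 h.
exists c => z i zS iz.
have [z1|z1] := pselect (S1 z); have [z2|z2] := pselect (S2 z).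
- have [m1 m10 n1] := L1 z i z1 iz; have [m2 m20 n2] := L2 z i z2 iz.
  have e : m1 = acomp (q z0) m2.
    apply: (@acompI _ _ _ (glue i (im2 (f z)))); first exact: glue_gt0.
    by rewrite -acompA -(nbhs_singleton n1) // -(nbhs_singleton n2) // -c1E // -c2E.
  exists m1 => //; apply: filterS2 (n1) (n2) => w e1 e2 [w1|w2]; first by rewrite c1E ?e1.
  by rewrite c2E // e2 // acompA -e.
- have [m1 m10 n1] := L1 z i z1 iz; exists m1 => //.
  by apply: filterS2 n1 (cl2 z z2) => w e1 nw2 [w1|//]; rewrite c1E ?e1.
- have [m2 m20 n2] := L2 z i z2 iz; exists (acomp (q z0) m2); first exact: acomp_gt0.
  by apply: filterS2 n2 (cl1 z z1) => w e2 nw1 [//|w2]; rewrite c2E // e2 // acompA.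
- by case: zS.
Qed.

(** Bisection takes the place of simple connectedness: lifts on the four quarters are glued along
    common edges, which are connected, and a small square maps into a single chart. *)
Lemma flat_lift_square (x y s : R) : 0 < s ->
  (forall z, rect x (x + s) y (y + s) z -> \forall w \near z, {for w, continuous f}) ->
  exists c, flat_lift (rect x (x + s) y (y + s)) c.
Proof.
move=> s0 cf.
apply: (@square_bisection R (fun x y s => exists c, flat_lift (rect x (x + s) y (y + s)) c)) => //.
  move=> {cf s0}{x}x {y}y {s}s s0 [c1 L1] [c2 L2] [c3 L3] [c4 L4].
  have ss (t : R) : t + s / 2 + s / 2 = t + s by rewrite -addrA -splitr.
  have lt (t : R) : t <= t + s / 2 <= t + s.
    by rewrite -(ss t) !lerDl; apply/andP; split; rewrite divr_ge0 // ltW.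
  rewrite ss in L2; rewrite ss in L3; rewrite !ss in L4.
  have H x1 x2 x3 y1' y2' c c' : x1 <= x2 <= x3 -> y1' <= y2' ->
      flat_lift (rect x1 x2 y1' y2') c -> flat_lift (rect x2 x3 y1' y2') c' ->
      exists c, flat_lift (rect x1 x3 y1' y2') c.
    move=> /andP[x12 x23] y12 l l'.
    have [| | | | |c0] := @flat_lift_glue _ _ _ _ (cplx x2 y1') _ _ _ _ _ l l'.
    - exact: rect_out.
    - exact: rect_out.
    - rewrite (_ : _ `&` _ = rect x2 x2 y1' y2'); first exact: rect_vert_connected.
      apply/seteqP; split=> z.
        by move=> [[/andP[a b] h] [/andP[a' b'] h']]; split => //; apply/andP.
      by move=> [/andP[a b] h]; split; split=> //; apply/andP; split => //; lra.
    - by split; rewrite /= ?lexx ?x12 ?y12.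
    - by split; rewrite /= ?lexx ?x23 ?y12.
    rewrite (_ : _ `|` _ = rect x1 x3 y1' y2'); first by exists c0.
    apply/seteqP; split=> z.
      by move=> [] [/andP[a b] h]; split=> //; apply/andP; split => //; lra.
    move=> [/andP[a b] h]; have [hh|hh] := leP (complex.Re z) x2; [left|right];
      by split=> //; apply/andP; split => //; lra.
  have K x1 x2 y1' y2' y3' c c' : x1 <= x2 -> y1' <= y2' <= y3' ->
      flat_lift (rect x1 x2 y1' y2') c -> flat_lift (rect x1 x2 y2' y3') c' ->
      exists c, flat_lift (rect x1 x2 y1' y3') c.
    move=> x12 /andP[y12 y23] l l'.
    have [| | | | |c0] := @flat_lift_glue _ _ _ _ (cplx x1 y2') _ _ _ _ _ l l'.
    - exact: rect_out.
    - exact: rect_out.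
    - rewrite (_ : _ `&` _ = rect x1 x2 y2' y2'); first exact: rect_horiz_connected.
      apply/seteqP; split=> z.
        by move=> [[h /andP[a b]] [h' /andP[a' b']]]; split => //; apply/andP.
      by move=> [h /andP[a b]]; split; split=> //; apply/andP; split => //; lra.
    - by split; rewrite /= ?lexx ?x12 ?y12.
    - by split; rewrite /= ?lexx ?x12 ?y23.
    rewrite (_ : _ `|` _ = rect x1 x2 y1' y3'); first by exists c0.
    apply/seteqP; split=> z.
      by move=> [] [h /andP[a b]]; split=> //; apply/andP; split => //; lra.
    move=> [h /andP[a b]]; have [hh|hh] := leP (complex.Im z) y2'; [left|right];
      by split=> //; apply/andP; split => //; lra.
  have /andP[xa xb] := lt x; have /andP[ya yb] := lt y.
  have [d1 l1] := H _ _ _ _ _ _ _ (lt x) ya L1 L2.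
  have [d2 l2] := H _ _ _ _ _ _ _ (lt x) yb L3 L4.
  exact: K (le_trans xa xb) (lt y) l1 l2.
move=> a b ha hb; set z0 := cplx a b.
have [i iz] := raw_in_chart (f z0).
have cz0 := cf z0 (conj ha hb).
have ni : \forall z \near z0, in_chart i (f z).
  have := @open_nbhs_nbhs _ (f z0) _ (conj (@bundle_open_chart_dom R i) iz).
  exact: (nbhs_singleton cz0).
have [d d0 hd] := (nbhsC _ _).1 (filterI ni cz0).
exists (d / 2) => [|x' y' s' s'0 s'd hx hy]; first by rewrite divr_gt0.
exists (fun z => glue i (im2 (f z))) => z j zS jz.
have [iz' cz] : in_chart i (f z) /\ {for z, continuous f}.
  apply: hd; have -> : z - z0 = cplx (complex.Re z - a) (complex.Im z - b) by case: (z).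
  apply: (le_lt_trans (Mod_le _ _)); case: zS => /andP[? ?] /andP[? ?].
  move: hx hy => /andP[? ?] /andP[? ?].
  have : `|complex.Re z - a| <= s' by rewrite ler_norml; apply/andP; split; lra.
  have : `|complex.Im z - b| <= s' by rewrite ler_norml; apply/andP; split; lra.
  lra.
have [ij|ij] := eqVneq i j.
  exists (1, 0) => //; apply: (@filterE _ (nbhs z) (nbhs_filter z)) => w _.
  by rewrite ij acomp1.
have sg := bundle_im2_sign_near (in_chart_neq ij iz' jz).
exists (acomp (glue i (im2 (f z))) (ainv (glue j (im2 (f z))))).
  by apply: acomp_gt0; [exact: glue_gt0 | apply: ainv_gt0; exact: glue_gt0].
apply: (@filterS _ (nbhs z) (nbhs_filter z) _ _ _ (cz _ sg)) => w sw _.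
have glueE k : glue k (im2 (f w)) = glue k (im2 (f z)).
  by rewrite /glue; rewrite /= in sw; rewrite sw.
by rewrite !glueE acompVK // glue_gt0.
Qed.

End Lifting.

(** * A vertical tangent vector and the bound on discs through it *)

Section Tangent.
Variable R : realType.
Notation C := (Cplx R).
Notation Y := (bundle_manifold R).

Lemma is_derive_coord (g : C -> 'rV[C]_3) (z : C) (j : 'I_3) : derivable g z 1 ->
  is_derive z 1 (fun w => g w 0 j) ('D_1 g z 0 j).
Proof.
move=> /derivableP[dg _].
have L : (h^-1 *: (g (h *: 1 + z) 0 j - g z 0 j)) @[h --> 0^'] --> 'D_1 g z 0 j.
  have cc : {for 'D_1 g z, continuous (fun M : 'rV[C]_3 => M 0 j)}.
    exact: coord_continuous.
  have D0 : (h^-1 *: (g (h *: 1 + z) - g z)) @[h --> 0^'] --> 'D_1 g z := dg.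
  apply: (cvg_trans _ (continuous_cvg _ cc D0)).
  by apply: near_eq_cvg; near=> h; rewrite /= !mxE.
by apply: DeriveDef; [apply/cvg_ex; eexists; exact: L | exact: cvg_lim L].
Unshelve. all: by end_near. Qed.

(** Over [Im z2 > 0] every chart is the raw trivialization. Hence the same coordinate vector in all
    charts at [base_pt] defines a tangent vector. *)
Lemma transition_diff (i j : nat) (x : bundle R) : 0 < im2 x ->
  'd (fun p => chart_coord j (of_coord i p)) (chart_coord i x) = id :> ('rV[C]_3 -> 'rV[C]_3).
Proof.
move=> x2; have ix : in_chart i x by left; rewrite gt_eqF.
have cx := coord_image_chart_coord ix.
have n1 : nbhs (chart_coord i x) (@coord_image R i).
  by apply: open_nbhs_nbhs; split => //; exact: open_coord_image.
have n2 : nbhs (chart_coord i x) [set p : 'rV[C]_3 | 0 < im2 p].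
  apply: open_nbhs_nbhs; split; first exact: open_Im_gt.
  by rewrite /= im2_shear.
have E : \forall p \near chart_coord i x, chart_coord j (of_coord i p) = id p.
  apply: nbhsVS (nbhsVI n1 n2) => p [cp p2].
  rewrite raw_of_coord // /chart_coord /chart_coord_inv im2_shear shear_comp /glue ltNge ltW //=.
  by rewrite acompNV ?shear_id.
rewrite (near_eq_diff E _).2; last by [].
exact: diff_val.
Qed.

Lemma fiber_tangent_compatible (phi psi : charts_at (base_pt R : Y)) :
  delta_mx 0 o2 =
  'd (sval psi \o chart_inv (sval phi)) (sval phi (base_pt R : Y)) (delta_mx 0 o2 : 'rV[C]_3).
Proof.
have [[i _ ei] _] := svalP phi; have [[j _ ej] _] := svalP psi.
have x2 : 0 < im2 (base_pt R) by rewrite /im2 row3_1 /= ltr01.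
rewrite -ei -ej.
exact: esym (congr1 (fun g : 'rV[C]_3 -> 'rV[C]_3 => g (delta_mx 0 o2))
  (transition_diff i j x2)).
Qed.

Definition fiber_tangent : tangent (base_pt R : Y) :=
  Tangent fiber_tangent_compatible.

(** The continued fibre coordinate [F] maps a square of half-side [1 / 6] into the half-plane. As
    [Im w = 1] at [base_pt], [half_plane_estimate] gives [16 * m.1 / (1 / 6) = 96 * m.1], and the
    factor [m.1] also multiplies the derivative, so it cancels. *)
Lemma disc_fiber_derivative (f : C -> Y) :
  holomorphic_disc f -> f 0 = base_pt R ->
  Mod ('D_1 (fun z => chart_coord 0 (f z : bundle R)) 0 0 o2) <= 96.
Proof.
move=> hf f0; pose s : R := 2 / 3.
(* The square of half-side [1 / 3] lies in the disc, because the modulus is at most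
   [1 / 3 + 1 / 3]. *)
have inside z : rect (- (1 / 3)) (- (1 / 3) + s) (- (1 / 3)) (- (1 / 3) + s) z -> unit_disc z.
  case: z => a b [/= /andP[a1 a2] /andP[b1 b2]]; apply/unit_discE.
  rewrite -/(cplx a b); apply: (le_lt_trans (Mod_le _ _)).
  have : `|a| <= 1 / 3 by rewrite ler_norml; apply/andP; split; rewrite /s in a2; lra.
  have : `|b| <= 1 / 3 by rewrite ler_norml; apply/andP; split; rewrite /s in b2; lra.
  lra.
have [||c Lc] := @flat_lift_square R (f : C -> bundle R) (- (1 / 3)) (- (1 / 3)) s.
- by rewrite /s; lra.
- move=> z /inside uz.
  have nz : nbhs z (@unit_disc R) by apply: open_nbhs_nbhs; split => //; exact: open_unit_disc.
  by apply: (@filterS _ (nbhs z) (nbhs_filter z) _ _ _ nz) => w /hf[].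
set S := rect _ _ _ _ in inside Lc.
(* [flat_lift] controls [c] only inside [S]; derivatives are taken on a smaller square, whose points
   are interior to [S]. *)
have int a b : `|a| <= 1 / 6 -> `|b| <= 1 / 6 -> nbhs (cplx a b) S.
  rewrite !ler_norml => /andP[a1 a2] /andP[b1 b2]; apply/nbhsC; exists (1 / 6); first lra.
  move=> w hw; have := le_lt_trans (Mod_ReB (cplx a b) w) hw.
  have := le_lt_trans (Mod_ImB (cplx a b) w) hw.
  rewrite /= !ltr_norml => /andP[h1 h2] /andP[h3 h4]; rewrite /S /rect /= /s.
  by split; apply/andP; split; lra.
pose F z := creal (c z).1 * raw (f z : bundle R) 0 o2 + creal (c z).2.
have loc a b i : `|a| <= 1 / 6 -> `|b| <= 1 / 6 -> in_chart i (f (cplx a b) : bundle R) ->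
   exists2 m : R * R, 0 < m.1 & is_derive (cplx a b) 1 F
     (creal m.1 * 'D_1 (fun z => chart_coord i (f z : bundle R)) (cplx a b) 0 o2) /\
     F (cplx a b) = creal m.1 * chart_coord i (f (cplx a b) : bundle R) 0 o2 + creal m.2.
  move=> ha hb iz; have nS := int a b ha hb.
  have [m m0 nm] := Lc _ i (nbhs_singleton nS) iz; exists m => //.
  pose G z := creal m.1 * chart_coord i (f z : bundle R) 0 o2 + creal m.2.
  have E : \forall z \near cplx a b, G z = F z.
    apply: filterS2 nS nm => z zS /(_ zS) cz.
    rewrite /G /F cz /acomp /= /chart_coord shear_o2 crealD !crealM; ring.
  split; last by rewrite -(nbhs_singleton E).
  have dg : derivable (fun z => chart_coord i (f z : bundle R)) (cplx a b) 1.
    have [_ h] := hf _ (inside _ (nbhs_singleton nS)).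
    by apply: (h (bundle_chart R i)) => //; exists i.
  have D := is_derive_coord o2 dg.
  apply: (near_eq_is_derive E).
  have D1 (k : C) : is_derive (cplx a b : C) (1 : C) (cst k : C -> C) 0 by exact: is_derive_cst.
  have := is_deriveD (is_deriveM (D1 (creal m.1)) D) (D1 (creal m.2)).
  have <- : G = cst (creal m.1) * (fun z => chart_coord i (f z : bundle R) 0 o2) + cst (creal m.2).
    by apply/funext.
  by move=> H; apply: (is_derive_eq H); rewrite addr0 scaler0 addr0.
have r6 : `|0 : R| <= 1 / 6 by rewrite normr0; lra.
have := @half_plane_estimate R F (1 / 6).
have b0 : in_chart 0 (f (cplx 0 0) : bundle R).
  by left; rewrite [f _]f0 /im2 row3_1 /= oner_neq0.
have [m m0 [D0 F0]] := loc 0 0 0%N r6 r6 b0.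
have -> : 'D_1 F 0 = creal m.1 * 'D_1 (fun z => chart_coord 0 (f z : bundle R)) 0 0 o2.
  by case: D0.
rewrite [F 0]F0 Im_affine ModM Mod_creal gtr0_norm //.
have -> : complex.Im (chart_coord 0 (f (cplx 0 0) : bundle R) 0 o2) = 1.
  rewrite [f _]f0 /chart_coord shear_o2 Im_affine /im2 /= row3_1 row3_2 /glue /=.
  by rewrite ltNge ler01 /= mulr1.
have -> : 16 * (m.1 * 1) / (1 / 6) = m.1 * 96 by field.
rewrite ler_pM2l //; apply; first lra.
  move=> a b ha hb; have [i iz] := raw_in_chart (f (cplx a b) : bundle R).
  by have [m' _ [[]]] := loc a b i ha hb iz.
move=> a b ha hb; have [i iz] := raw_in_chart (f (cplx a b) : bundle R).
have [m' m'0 [_ ->]] := loc a b i ha hb iz; rewrite Im_affine mulr_gt0 //.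
by have [] := coord_image_chart_coord iz.
Qed.

End Tangent.

Local Open Scope ereal_scope.

Theorem theorem5p1 (R : realType) :
  exists Y : complexManifold R,
    (forall p q : Y, kobayashi_dist p q = 0) /\
    (exists (x : Y) (v : tangent x), kobayashi_royden v <> 0).
Proof.
exists (bundle_manifold R); split; first exact: kobayashi_dist_bundle.
exists (base_pt R), (fiber_tangent R) => F0.
suff : (96^-1%:E <= kobayashi_royden (fiber_tangent R))%E.
  by rewrite F0 lee_fin leNgt invr_gt0 ltr0n.
apply: le_ereal_inf_tmp => _ [l [l0 [f [hf f0 hl]]] <-]; rewrite lee_fin.
have b0 : chart_dom (bundle_chart R 0) (base_pt R).
  by left; rewrite /im2 row3_1 /= oner_neq0.
have c0 : atlas (c := bundle_manifold R) (bundle_chart R 0) by exists 0%N.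
have := hl (exist _ (bundle_chart R 0) (conj c0 b0)).
rewrite derive1E /= => /(congr1 (fun p : 'rV[Cplx R]_3 => Mod (p ord0 o2))).
rewrite !mxE /= ModM => e.
have D96 := disc_fiber_derivative hf f0.
(* The fibre component of the tangent vector is 1, so [l] times a number that is at most 96 equals
   1. *)
have {}e : (l * Mod ('D_1 (fun z => chart_coord 0 (f z : bundle R)) 0 ord0 o2) = 1)%R.
  by rewrite -[RHS](@normr1 R) -(Mod_creal 1) -[creal 1]/(1 : Cplx R)%R -e;
    rewrite -[X in (Mod X * _)%R]/(creal l) Mod_creal gtr0_norm.
rewrite -(ler_pM2r (_ : 0 < 96)%R) ?ltr0n // mulVf ?pnatr_eq0 // -[leLHS]e.
by rewrite ler_pM2l.
Qed.
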